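(* Let $N\ge2$ and $\alpha\in\triangle_N$ be fixed. There is an algorithm which, given an integer $m\ge0$ and $\varepsilon>0$, computes estimates of the moments $I_1,\dots,I_m$ of $\mu^\alpha$ (or, if $\alpha$ is palindromic, of the moments $J_1,\dots,J_m$ of $\nu^\alpha$) within uniform error at most $\varepsilon$ (i.e. each estimate differs from the true moment by at most $\varepsilon$) in time $O(\log\log(1/\varepsilon)\cdot m\log m)$.
   Context: $\triangle_N$ is the set of $\alpha=(\alpha_0,\dots,\alpha_{N-1})\in\mathbb{R}^N$ with all $\alpha_n\ge 0$ and $\sum_n\alpha_n=1$; $\alpha$ is palindromic if $\alpha_{N-1-n}=\alpha_n$ for all $n$. For $\alpha\in\triangle_N$ with $N\ge2$, the $\alpha$-weighted Cantor measure $\mu^\alpha$ is the unique Borel probability measure on $\mathbb{R}$ supported in $[0,1]$ satisfying $\mu^\alpha(E)=\sum_{n=0}^{N-1}\alpha_n\mu^\alpha(\varphi_n^{-1}(E))$ for all Borel sets $E$, where $\varphi_n(x)=(x+n)/N$. Its moments are $I_j=\int_0^1x^j\,d\mu^\alpha(x)$. The measure $\nu^\alpha$ is the translate of $\mu^\alpha$ from $[0,1]$ to $[-1/2,1/2]$, with moments $J_j=\int_{-1/2}^{1/2}x^j\,d\nu^\alpha(x)=\int_0^1(x-1/2)^j\,d\mu^\alpha(x)$. Running time is measured by the number of arithmetic operations on numbers, with two polynomials of degree at most $m$ multiplied in $O(m\log m)$ operations by the Fast Fourier Transform; the $O(\cdot)$ is asymptotic, for large $m$ and small $\varepsilon$ (so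 that $\log\log(1/\varepsilon)$ is positive and bounded below), with implied constant allowed to depend on the fixed $N$ and $\alpha$. *)

(* Defs.v *)
(* MathComp / MathComp-Analysis *)
From HB Require Import structures.
From mathcomp Require Import all_boot all_order all_algebra.
From mathcomp Require Import all_classical all_reals all_analysis.
From mathcomp Require Import measurable_realfun.
Set Implicit Arguments.
Unset Strict Implicit.
Unset Printing Implicit Defensive.
Import Order.TTheory GRing.Theory Num.Theory.
Import numFieldNormedType.Exports.
Local Open Scope classical_set_scope.
Local Open Scope ring_scope.

Definition in_simplex (R : realType) (N : nat) (alpha : 'I_N -> R) : Prop :=
  (forall n, 0 <= alpha n) /\ \sum_(n < N) alpha n = 1.

Definition palindromic (R : realType) (N : nat) (alpha : 'I_N -> R) : Prop :=
  forall n, alpha (rev_ord n) = alpha n.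

Definition cantor_map (R : realType) (N n : nat) (x : R) : R :=
  (x + n%:R) / N%:R.

Definition is_weighted_cantor (R : realType) (N : nat) (alpha : 'I_N -> R)
    (mu : probability (measurableTypeR R) R) : Prop :=
  mu (~` `[0, 1]%classic) = 0%E /\
  forall E : set (measurableTypeR R), measurable E ->
    mu E = (\sum_(n < N) (alpha n)%:E * mu (cantor_map N n @^-1` E))%E.

Definition recenter (R : realType) (x : measurableTypeR R) :
  measurableTypeR R := (x : R) - 2^-1.

Lemma measurable_recenter (R : realType) :
  measurable_fun [set: measurableTypeR R] (@recenter R).
Proof. exact: (@measurable_realfun.measurable_funB _ _ R setT (fun x => x) (cst 2^-1)). Qed.

HB.instance Definition _ (R : realType) :=
  isMeasurableFun.Build _ _ (measurableTypeR R) (measurableTypeR R)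
    (@recenter R) (@measurable_recenter R).

Definition moment_I (R : realType)
    (mu : probability (measurableTypeR R) R) (j : nat) : R :=
  \int[mu]_(x in `[0, 1]) x ^+ j.

Definition moment_J (R : realType)
    (mu : probability (measurableTypeR R) R) (j : nat) : R :=
  \int[distribution mu (@recenter R)]_(x in `[- 2^-1, 2^-1]) x ^+ j.

(* Model of computation: a real RAM running while-programs.  The memory holds
   natural-number variables, used for counting and indexing, and arrays of
   exact real numbers (a scalar is a cell of an array).  Programs are finite
   syntactic objects; their only real literals are rational, so a program
   depending on N and alpha cannot hard-wire the moments.  The real operations
   are + - * / and the square root, which provides the roots of unity of the
   Fast Fourier Transform.  Index arithmetic is limited to + and (truncated) -
   because unit-cost multiplication and division of unbounded integers could
   pack a whole polynomial product into one step. *)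

Inductive nexp : Type :=
| NLit of nat
| NVar of nat
| NAdd of nexp & nexp
| NSub of nexp & nexp.

Inductive rexp : Type :=
| RLit of rat
| RGet of nat & nexp
| RAdd of rexp & rexp
| RSub of rexp & rexp
| RMul of rexp & rexp
| RDiv of rexp & rexp
| RSqrt of rexp.

Inductive test : Type :=
| NLt of nexp & nexp
| RLt of rexp & rexp.

Inductive prog : Type :=
| Skip
| NSet of nat & nexp
| RSet of nat & nexp & rexp
| Seq of prog & prog
| If of test & prog & prog
| While of test & prog.

Record state (R : realType) : Type := State {
  nvar : nat -> nat;
  cell : nat -> nat -> R }.

Fixpoint neval (R : realType) (s : state R) (e : nexp) : nat :=
  match e with
  | NLit k => k
  | NVar x => nvar s x
  | NAdd e1 e2 => (neval s e1 + neval s e2)%N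
  | NSub e1 e2 => (neval s e1 - neval s e2)%N
  end.

Fixpoint reval (R : realType) (s : state R) (e : rexp) : R :=
  match e with
  | RLit q => ratr q
  | RGet a i => cell s a (neval s i)
  | RAdd e1 e2 => reval s e1 + reval s e2
  | RSub e1 e2 => reval s e1 - reval s e2
  | RMul e1 e2 => reval s e1 * reval s e2
  | RDiv e1 e2 => reval s e1 / reval s e2
  | RSqrt e1 => Num.sqrt (reval s e1)
  end.

Definition teval (R : realType) (s : state R) (b : test) : bool :=
  match b with
  | NLt e1 e2 => (neval s e1 < neval s e2)%N
  | RLt e1 e2 => reval s e1 < reval s e2
  end.

Definition set_nvar (R : realType) (s : state R) (x v : nat) : state R :=
  State (fun y => if y == x then v else nvar s y) (cell s).

Definition set_cell (R : realType) (s : state R) (a i : nat) (v : R) : state R :=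
  State (nvar s)
    (fun b j => if (b == a) && (j == i) then v else cell s b j).

(* Every literal, memory access, operation, comparison and assignment costs
   one unit, so the running time dominates the number of arithmetic
   operations. *)

Fixpoint ncost (e : nexp) : nat :=
  match e with
  | NLit _ | NVar _ => 1
  | NAdd e1 e2 | NSub e1 e2 => (ncost e1 + ncost e2).+1%N
  end.

Fixpoint rcost (e : rexp) : nat :=
  match e with
  | RLit _ => 1
  | RGet _ i => (ncost i).+1
  | RAdd e1 e2 | RSub e1 e2 | RMul e1 e2 | RDiv e1 e2 =>
      (rcost e1 + rcost e2).+1%N
  | RSqrt e1 => (rcost e1).+1
  end.

Definition tcost (b : test) : nat :=
  match b with
  | NLt e1 e2 => (ncost e1 + ncost e2).+1%N
  | RLt e1 e2 => (rcost e1 + rcost e2).+1%N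
  end.

(* [run p s t s']: started in s, the program p halts in s' after t units. *)
Inductive run (R : realType) : prog -> state R -> nat -> state R -> Prop :=
| run_skip s : run Skip s 0 s
| run_nset s x e :
    run (NSet x e) s (ncost e).+1 (set_nvar s x (neval s e))
| run_rset s a i e :
    run (RSet a i e) s (ncost i + rcost e).+1%N
      (set_cell s a (neval s i) (reval s e))
| run_seq p q s1 t1 s2 t2 s3 :
    run p s1 t1 s2 -> run q s2 t2 s3 -> run (Seq p q) s1 (t1 + t2)%N s3
| run_if_true b p q s t s' :
    teval s b -> run p s t s' -> run (If b p q) s (tcost b + t)%N s'
| run_if_false b p q s t s' :
    ~~ teval s b -> run q s t s' -> run (If b p q) s (tcost b + t)%N s'
| run_while_false b p s :
    ~~ teval s b -> run (While b p) s (tcost b) s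
| run_while_true b p s1 t1 s2 t2 s3 :
    teval s1 b -> run p s1 t1 s2 -> run (While b p) s2 t2 s3 ->
    run (While b p) s1 (tcost b + (t1 + t2))%N s3.

Lemma run_deterministic (R : realType) (p : prog) (s : state R) t1 s1 t2 s2 :
  run p s t1 s1 -> run p s t2 s2 -> t1 = t2 /\ s1 = s2.
Proof.
move=> r1; elim: r1 t2 s2 => {p s t1 s1}
  [s|s x e|s a i e|p q s1 u1 s2 u2 s3 _ IH1 _ IH2|b p q s u s1 bT _ IH
  |b p q s u s1 bF _ IH|b p s bF|b p s1 u1 s2 u2 s3 bT _ IH1 _ IH2] t s' r;
  inversion r; subst => //.
all: repeat match goal with
  | bT : is_true (teval _ _), bF : is_true (~~ teval _ _) |- _ =>
      by rewrite bT in bF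
  | IH : forall t s', run ?q ?s0 t s' -> _, rq : run ?q ?s0 _ _ |- _ =>
      case: (IH _ _ rq) => ? ?; subst; clear IH
  end; by [].
Qed.

(* Input: m in variable 0, eps in cell 0 of array 0, alpha in array 1;
   everything else is 0. *)
Definition input (R : realType) (N : nat) (alpha : 'I_N -> R) (m : nat)
    (eps : R) : state R :=
  State (fun x => if x == 0%N then m else 0%N)
    (fun a i =>
       if a == 0%N then (if i == 0%N then eps else 0)
       else if a == 1%N then oapp alpha 0 (insub i : option 'I_N)
       else 0).

(* On every input m, eps > 0 the program p halts after T m eps units, with an
   estimate of c j in cell j of array 2, for j = 1, ..., m. *)
Definition estimates_in_time (R : realType) (N : nat) (alpha : 'I_N -> R)
    (p : prog) (c : nat -> R) (T : nat -> R -> nat) : Prop :=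
  forall (m : nat) (eps : R), 0 < eps ->
    exists2 s : state R, run p (input alpha m eps) (T m eps) s &
      forall j : nat, (1 <= j <= m)%N -> `|cell s 2 j - c j| <= eps.

(* T m eps = O(log log (1/eps) * m log m) for large m and small eps. *)
Definition time_bound (R : realType) (T : nat -> R -> nat) : Prop :=
  exists (C : R) (m0 : nat) (eps0 : R), 0 < eps0 /\
    forall (m : nat) (eps : R), (m0 <= m)%N -> 0 < eps -> eps <= eps0 ->
      (T m eps)%:R <= C * (ln (ln eps^-1) * (m%:R * ln m%:R)).

(* Main.v *)
Require Import Defs.
From HB Require Import structures.
From mathcomp Require Import all_boot all_order all_algebra.
From mathcomp Require Import all_classical all_reals all_analysis.
From mathcomp Require Import measurable_realfun.
From mathcomp Require Import zify ring lra.
Set Implicit Arguments.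
Unset Strict Implicit.
Unset Printing Implicit Defensive.
Import Order.TTheory GRing.Theory Num.Theory.
Import numFieldNormedType.Exports.
Local Open Scope classical_set_scope.
Local Open Scope ring_scope.

(* Let s be 0 or 1/2 and T f x = sum_n alpha_n f ((x + n) / N), so that f and
   T f have the same integral.  For monotone f the oscillation of T f on [0, 1]
   is at most max alpha times that of f, because the images of [0, 1] under the
   maps tile [0, 1].  As (x - s)^j is a combination of two monotone functions of
   total oscillation at most 1, its integral is within (max alpha)^K of
   (T^K (x - s)^j)(s), uniformly in j.  Divided by j!, the latter numbers are the
   coefficients of prod_(k <= K) P (t / N^k), where
   P t = sum_n alpha_n exp ((n - s (N - 1)) t), and replacing K by 2 K costs one
   product of truncated power series.  Hence O(log log (1/eps)) products suffice
   when max alpha < 1; otherwise mu is a point mass and the same program, started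
   at the exact coefficients, runs no round.

   Products are computed modulo X^n + 1 by Bruun's factorization
   X^(4h) - (s^2 - 2) X^(2h) + 1
     = (X^(2h) - s X^h + 1) (X^(2h) + s X^h + 1),
   an FFT over the reals whose only irrationalities are square roots.  The
   interleaved data layout of Pease makes every level a single flat loop, so
   that no index has to be multiplied or divided. *)

(** * Running time and correctness of programs *)

Fixpoint straight (p : prog) : bool :=
  match p with
  | Skip | NSet _ _ | RSet _ _ _ => true
  | Seq p q | If _ p q => straight p && straight q
  | While _ _ => false
  end.

Fixpoint exec (R : realType) (p : prog) (s : state R) : state R :=
  match p with
  | Skip => s
  | NSet x e => set_nvar s x (neval s e)
  | RSet a i e => set_cell s a (neval s i) (reval s e)
  | Seq p q => exec q (exec p s)
  | If b p q => if teval s b then exec p s else exec q s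
  | While _ _ => s
  end.

Fixpoint pcost (p : prog) : nat :=
  match p with
  | Skip => 0
  | NSet _ e => (ncost e).+1
  | RSet _ i e => (ncost i + rcost e).+1
  | Seq p q => pcost p + pcost q
  | If b p q => tcost b + maxn (pcost p) (pcost q)
  | While _ _ => 0
  end.

Fixpoint nwrites (p : prog) : seq nat :=
  match p with
  | Skip | RSet _ _ _ => [::]
  | NSet x _ => [:: x]
  | Seq p q | If _ p q => nwrites p ++ nwrites q
  | While _ p => nwrites p
  end.

Fixpoint awrites (p : prog) : seq nat :=
  match p with
  | Skip | NSet _ _ => [::]
  | RSet a _ _ => [:: a]
  | Seq p q | If _ p q => awrites p ++ awrites q
  | While _ p => awrites p
  end.

(** The frame condition is read off the syntax, so that specifications need to describe only what
    changes. *)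
Definition frame (R : realType) (p : prog) (s s' : state R) : Prop :=
  (forall x, x \notin nwrites p -> nvar s' x = nvar s x) /\
  (forall a, a \notin awrites p -> cell s' a = cell s a).

(** A total-correctness triple with a cost bound. An upper bound, unlike an exact cost, composes
    across conditionals. *)
Definition ends (R : realType) (p : prog) (s : state R) (c : nat)
    (Q : state R -> Prop) : Prop :=
  exists t s', [/\ run p s t s', (t <= c)%N & Q s'].

Lemma run_frame (R : realType) (p : prog) (s : state R) t s' :
  run p s t s' -> frame p s s'.
Proof.
elim=> {p s t s'} [s|s x e|s a i e|p q s1 t1 s2 t2 s3 _ IH1 _ IH2
  |b p q s t s' _ _ IH|b p q s t s' _ _ IH|b p s _
  |b p s1 t1 s2 t2 s3 _ _ IH1 _ IH2]; split=> //= y.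
- by rewrite inE => /negPf ->.
- rewrite inE => /negPf hy; apply: funext => j /=.
  by rewrite hy.
- by rewrite mem_cat negb_or => /andP[h1 h2]; rewrite IH2.1 // IH1.1.
- by rewrite mem_cat negb_or => /andP[h1 h2]; rewrite IH2.2 // IH1.2.
- by rewrite mem_cat negb_or => /andP[h1 h2]; rewrite IH.1.
- by rewrite mem_cat negb_or => /andP[h1 h2]; rewrite IH.2.
- by rewrite mem_cat negb_or => /andP[h1 h2]; rewrite IH.1.
- by rewrite mem_cat negb_or => /andP[h1 h2]; rewrite IH.2.
- by move=> h; rewrite IH2.1 // IH1.1.
- by move=> h; rewrite IH2.2 // IH1.2.
Qed.

Lemma frame_refl (R : realType) (p : prog) (s : state R) : frame p s s.
Proof. by []. Qed.

Lemma frame_trans (R : realType) (p : prog) (s1 s2 s3 : state R) :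
  frame p s1 s2 -> frame p s2 s3 -> frame p s1 s3.
Proof.
by move=> [n1 a1] [n2 a2]; split=> y hy; rewrite ?n2 ?a2 // ?n1 ?a1.
Qed.

(** The rule of consequence; the frame condition comes for free when the postcondition is
    weakened. *)
Lemma ends_mono (R : realType) (p : prog) (s : state R) c c' (Q Q' : state R -> Prop) :
  ends p s c Q -> (c <= c')%N -> (forall s', frame p s s' -> Q s' -> Q' s') ->
  ends p s c' Q'.
Proof.
move=> [t [s' [r tc q]]] cc' h; exists t, s'; split=> //.
  exact: leq_trans tc cc'.
exact: h (run_frame r) q.
Qed.

Lemma ends_seq (R : realType) (p q : prog) (s : state R) c1 c2 Q Q' :
  ends p s c1 Q ->
  (forall s', frame p s s' -> Q s' -> ends q s' c2 Q') ->
  ends (Seq p q) s (c1 + c2) Q'.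
Proof.
move=> [t1 [s1 [r1 t1c q1]]] h.
have [t2 [s2 [r2 t2c q2]]] := h _ (run_frame r1) q1.
by exists (t1 + t2)%N, s2; split=> //; [exact: run_seq r1 r2|exact: leq_add].
Qed.

Lemma run_exec (R : realType) (p : prog) (s : state R) : straight p ->
  exists2 t, run p s t (exec p s) & (t <= pcost p)%N.
Proof.
elim: p s => //= [s|x e s|a i e s|p IHp q IHq s|b p IHp q IHq s] => [_|_|_||].
- by exists 0%N => //; constructor.
- by exists (ncost e).+1 => //; constructor.
- by exists (ncost i + rcost e).+1 => //; constructor.
- move=> /andP[hp hq]; have [t1 r1 c1] := IHp s hp.
  have [t2 r2 c2] := IHq (exec p s) hq.
  by exists (t1 + t2)%N; [exact: run_seq r1 r2|exact: leq_add].
- move=> /andP[hp hq]; case: ifPn => hb.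
    have [t r c] := IHp s hp; exists (tcost b + t)%N; first exact: run_if_true.
    by rewrite leq_add2l (leq_trans c) // leq_maxl.
  have [t r c] := IHq s hq; exists (tcost b + t)%N; first exact: run_if_false.
  by rewrite leq_add2l (leq_trans c) // leq_maxr.
Qed.

Lemma ends_straight (R : realType) (p : prog) (s : state R) (Q : state R -> Prop) :
  straight p -> Q (exec p s) -> ends p s (pcost p) Q.
Proof. by move=> /(run_exec s)[t r c] q; exists t, (exec p s). Qed.

Lemma exec_frame (R : realType) (p : prog) (s : state R) :
  straight p -> frame p s (exec p s).
Proof. by move=> /(run_exec s)[t r _]; exact: run_frame r. Qed.

(** The invariant is indexed by the number of rounds already done and the test fails exactly after
    [L] of them, so induction runs on the remaining rounds. The last summand pays for the failing
    test. *)
Lemma ends_while (R : realType) (b : test) (p : prog) (s : state R) (c L : nat)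
    (I : nat -> state R -> Prop) :
  I 0%N s ->
  (forall k s', (k <= L)%N -> frame p s s' -> I k s' -> teval s' b = (k < L)%N) ->
  (forall k s', (k < L)%N -> frame p s s' -> I k s' -> ends p s' c (I k.+1)) ->
  ends (While b p) s (L * (tcost b + c) + tcost b) (I L).
Proof.
move=> I0 hb hp.
suff gen d k s1 : (k + d = L)%N -> frame p s s1 -> I k s1 ->
    ends (While b p) s1 (d * (tcost b + c) + tcost b) (I L).
  exact: (gen L 0%N s _ (frame_refl _ s) I0).
elim: d k s1 => [|d IH] k s1 kdL fr Ik.
  exists (tcost b), s1; split=> //.
    apply: run_while_false; rewrite (hb k) //; lia.
  by rewrite addn0 in kdL; rewrite -kdL.
have kL : (k < L)%N by lia.
have [t1 [s2 [r1 c1 I1]]] := hp k s1 kL fr Ik.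
have [|t2 [s3 [r2 c2 I2]]] := IH k.+1 s2 _ (frame_trans fr (run_frame r1)) I1.
  by lia.
exists (tcost b + (t1 + t2))%N, s3; split=> //.
  by apply: run_while_true r1 r2; rewrite (hb k) // ltnW.
by rewrite mulSn; lia.
Qed.

Definition For (e : nexp) (body : prog) : prog :=
  Seq (NSet 3 (NLit 0))
      (While (NLt (NVar 3) e) (Seq body (NSet 3 (NAdd (NVar 3) (NLit 1))))).

(** The bound [e] keeps its value during the loop and [body] leaves the counter alone, so exactly
    [n] rounds are run. *)
Lemma ends_for (R : realType) (e : nexp) (body : prog) (s : state R) (n : nat)
    (I : nat -> state R -> Prop) :
  straight body -> 3%N \notin nwrites body ->
  (forall s', frame (For e body) s s' -> neval s' e = n) ->
  (forall s', frame (NSet 3 (NLit 0)) s s' -> nvar s' 3 = 0%N -> I 0%N s') ->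
  (forall k s', (k < n)%N -> frame (For e body) s s' -> nvar s' 3 = k -> I k s' ->
     I k.+1 (set_nvar (exec body s') 3 k.+1)) ->
  ends (For e body) s (2 + (n * (pcost body + 6 + ncost e) + (2 + ncost e))) (I n).
Proof.
move=> hs h3 he h0 hI.
apply: (ends_seq (c1 := 2) (Q := fun s' => nvar s' 3 = 0%N)).
  exact: ends_straight.
move=> s1 f1 s1_3.
have f1' : frame (For e body) s s1.
  split=> [x|a] h; [apply: f1.1|exact: f1.2].
  by move: h; rewrite /= !inE !negb_or => /andP[].
set p := Seq body _.
have fext s' : frame p s1 s' -> frame (For e body) s s'.
  move=> f2; apply: frame_trans f1' _; split=> [x|a].
    rewrite /= inE negb_or => /andP[_ h]; exact: f2.1.
  exact: f2.2.
have := @ends_while R (NLt (NVar 3) e) p s1 (pcost body + 4) n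
  (fun k s' => nvar s' 3 = k /\ I k s').
move=> H; apply: ends_mono (H _ _ _) _ _.
- by split=> //; exact: h0.
- by move=> k s' kn f2 [s'3 _] /=; rewrite s'3 he //; exact: fext.
- move=> k s' kn f2 [s'3 Ik].
  have fb : nvar (exec body s') 3 = k.
    by have [t r _] := run_exec s' hs; rewrite (run_frame r).1.
  have hp : pcost p = (pcost body + 4)%N by [].
  rewrite -hp; apply: ends_straight => /=; first by rewrite hs.
  split; first by rewrite fb addn1.
  by rewrite fb addn1; apply: hI => //; exact: fext.
- by rewrite /tcost /ncost -/ncost leq_eqVlt; apply/orP; left; apply/eqP; ring.
- by move=> s' _ [].
Qed.

(** * Bruun's factorization *)

Section Bruun.
Variable R : numFieldType.
Implicit Types (F G H : {poly R}) (w s : R) (u : nat -> R).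

(** For w = 2 cos t this is (X^M - exp(i t)) (X^M - exp(-i t)); the top of the tree has w = 0. *)
Definition bruun w (M : nat) : {poly R} := 'X^(M + M) - w%:P * 'X^M + 1.

Lemma size_bruun w M : (0 < M)%N -> size (bruun w M) = (M + M).+1.
Proof.
move=> M0; rewrite /bruun -addrA size_polyDl ?size_polyXn //.
apply: leq_ltn_trans (_ : (M.+1 < _)%N); last by lia.
apply: (leq_trans (size_polyD _ _)); rewrite geq_max size_poly1 andbT.
rewrite size_polyN; apply: (leq_trans (size_polyMleq _ _)).
by rewrite size_polyXn addnS /= -add1n leq_add2r size_polyC_leq1.
Qed.

(** A difference of squares: (X^(2h) + 1)^2 - (s X^h)^2. *)
Lemma bruun_mul s h : bruun (s ^+ 2 - 2) (h + h) = bruun s h * bruun (- s) h.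
Proof.
rewrite /bruun !exprD rmorphB rmorphXn rmorph_nat rmorphN /=; ring.
Qed.

Lemma modp_dvd_modulus F D D' : D' %| D -> (F %% D) %% D' = F %% D'.
Proof.
move=> hD; rewrite {2}(divp_eq F D) modpD.
by rewrite [X in X + _](_ : _ = 0) ?add0r //; apply/modp_eq0P/dvdp_mull.
Qed.

Lemma poly_split4 G h : (size G <= h + h + h + h)%N ->
  G = \poly_(i < h) G`_i + 'X^h * \poly_(i < h) G`_(h + i)
    + 'X^(h + h) * \poly_(i < h) G`_(h + h + i)
    + 'X^(h + h + h) * \poly_(i < h) G`_(h + h + h + i).
Proof.
move=> hG; apply/polyP => i; rewrite !coefD !coefXnM !coef_poly.
have [i1|i1] := ltnP i h; first by rewrite !ifT ?addr0 //; lia.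
rewrite add0r.
have [i2|i2] := ltnP i (h + h)%N.
  rewrite !ifT ?addr0 ?subnKC //; lia.
rewrite ifF ?add0r; last lia.
have [i3|i3] := ltnP i (h + h + h)%N.
  by rewrite ifT ?addr0 ?subnKC //; lia.
rewrite ifF ?add0r; last lia.
case: ifP => i4; first by rewrite subnKC.
by rewrite nth_default //; apply: leq_trans hG _; lia.
Qed.

(** Modulo [bruun s h] one has X^(2h) = s X^h - 1, hence X^(3h) = (s^2 - 1) X^h - s, which folds
    four blocks of length h into two. *)
Lemma modp_bruun G s h : (0 < h)%N -> (size G <= h + h + h + h)%N ->
  G %% bruun s h =
    \poly_(i < h) (G`_i - G`_(h + h + i) - s * G`_(h + h + h + i))
  + 'X^h * \poly_(i < h)
      (G`_(h + i) + s * G`_(h + h + i) + (s ^+ 2 - 1) * G`_(h + h + h + i)).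
Proof.
move=> h0 hG; set A := \poly_(i < h) _; set B := \poly_(i < h) _.
pose P (k : nat) := \poly_(i < h) G`_(k + i).
have hA : A = P 0%N - P (h + h)%N - s%:P * P (h + h + h)%N.
  apply/polyP => i; rewrite !(coefB, coefCM, coef_poly).
  by case: ifP => //; rewrite mulr0 !subr0.
have hB : B = P h + s%:P * P (h + h)%N + (s ^+ 2 - 1)%:P * P (h + h + h)%N.
  apply/polyP => i; rewrite !(coefD, coefCM, coef_poly).
  by case: ifP => //; rewrite !mulr0 !addr0.
(* The quotient is explicit; a degree count then identifies the remainder. *)
have -> : G = (P (h + h)%N + ('X^h + s%:P) * P (h + h + h)%N) * bruun s h
              + (A + 'X^h * B).
  rewrite {1}(poly_split4 hG) hA hB /bruun !exprD rmorphB rmorphXn /= polyC1.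
  rewrite -[\poly_(i < h) G`_i]/(P 0%N) -/(P h) -/(P (h + h)%N).
  rewrite -/(P (h + h + h)%N); ring.
rewrite modp_addl_mul_small // size_bruun //.
apply: (leq_ltn_trans (size_polyD _ _)); rewrite gtn_max ltnS.
have sB : (size B <= h)%N by exact: size_poly.
have sA : (size A <= h)%N by exact: size_poly.
apply/andP; split; first by rewrite (leq_trans sA) // leq_addr.
apply: (leq_ltn_trans (size_polyMleq _ _)).
by rewrite size_polyXn addSn ltnS leq_add2l.
Qed.

(** The child modulus divides its parent, so the child residue is computed from the parent residue
    without returning to [F]. *)
Lemma coef_modp_bruun F s h i : (0 < h)%N -> (i < h)%N ->
  let G := F %% bruun (s ^+ 2 - 2) (h + h) in
  (F %% bruun s h)`_i = G`_i - G`_(h + h + i) - s * G`_(h + h + h + i) /\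
  (F %% bruun s h)`_(h + i) =
    G`_(h + i) + s * G`_(h + h + i) + (s ^+ 2 - 1) * G`_(h + h + h + i).
Proof.
move=> h0 ih G.
have sG : (size G <= h + h + h + h)%N.
  have D0 : bruun (s ^+ 2 - 2) (h + h) != 0.
    by rewrite -size_poly_gt0 size_bruun // addn_gt0 h0.
  have := ltn_modpN0 F D0; rewrite size_bruun ?addn_gt0 ?h0 // ltnS -/G; lia.
have <- : G %% bruun s h = F %% bruun s h.
  by apply: modp_dvd_modulus; rewrite bruun_mul dvdp_mulr.
rewrite modp_bruun // !coefD !coefXnM !coef_poly ih addr0; split => //.
have -> : (h + i < h)%N = false by lia.
by rewrite add0r addKn ih.
Qed.

(* Residues of F modulo the B factors of X^(2MB) + 1 at a level of the tree,
   in Pease's interleaved order: with j = i * B + b, entry j is coefficient i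
   of the residue of index b.  Nodes are numbered as in a heap, so the factors
   of this level have the parameters u (B + b). *)
Definition residue u F (M B j : nat) : R :=
  (F %% bruun (u (B + j %% B)%N) M)`_(j %/ B).

Lemma residueE u F M B i b : (b < B)%N ->
  residue u F M B (i * B + b) = (F %% bruun (u (B + b)%N) M)`_i.
Proof.
move=> bB; rewrite /residue modnMDl modn_small // divnMDl; last by lia.
by rewrite divn_small // addn0.
Qed.

(** The children of node b carry the two roots s of s^2 - 2 = u b. Node 1 stands for X^(4q) + 1.
    Nonvanishing allows the inverse transform to divide by 2 s. *)
Definition root_table (q : nat) u : Prop :=
  u 1%N = 0 /\
  forall b, (0 < b < q + q)%N ->
    [/\ u (b + b)%N ^+ 2 = 2 + u b, u (b + b + 1)%N = - u (b + b)%N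
      & u (b + b)%N != 0].

(** As q = h B, adding q to an index raises the coefficient by h within the same block. One level
    down, 2 j and 2 j + 1 address the same coefficient in blocks 2 b and 2 b + 1. Hence addition is
    the only index operation. *)
Lemma residue_step u F q h B j (b := (j %% B)%N)
    (w := u (B + b)%N) (s := u (B + b + (B + b))%N)
    (a := residue u F (h + h) B) (c := residue u F h (B + B)) :
  q = (h * B)%N -> root_table q u -> (0 < B)%N -> (j < q)%N ->
  [/\ c (j + j)%N = a j - a (j + (q + q))%N - s * a (j + (q + q + q))%N,
      c (j + j + 1)%N = a j - a (j + (q + q))%N + s * a (j + (q + q + q))%N,
      c (j + j + (q + q))%N = a (j + q)%N + (1 + w) * a (j + (q + q + q))%N
                              + s * a (j + (q + q))%N
    & c (j + j + (q + q) + 1)%N = a (j + q)%N + (1 + w) * a (j + (q + q + q))%N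
                              - s * a (j + (q + q))%N].
Proof.
move=> qE [_ hu] B0 jq.
have h0 : (0 < h)%N by case: h qE jq {a c} => // ->; rewrite mul0n.
pose i := (j %/ B)%N.
have bB : (b < B)%N by rewrite ltn_mod.
have ih : (i < h)%N by rewrite ltn_divLR // -qE.
have jE : j = (i * B + b)%N by rewrite -divn_eq.
have Bq : (B <= q)%N by rewrite qE leq_pmull.
have [|hs ho _] := hu (B + b)%N; first by lia.
rewrite -/s -/w in hs ho.
have hw : w = s ^+ 2 - 2 by rewrite hs; ring.
have aE (k l : nat) : l = (k * B + b)%N -> a l = (F %% bruun w (h + h))`_k.
  by move=> ->; rewrite /a residueE.
have c0E (k l : nat) : l = (k * (B + B) + (b + b))%N ->
    c l = (F %% bruun s h)`_k.
  move=> ->; rewrite /c residueE; last by lia.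
  by rewrite /s; congr (_ %% bruun (u _) _)`_ _; lia.
have c1E (k l : nat) : l = (k * (B + B) + (b + b + 1))%N ->
    c l = (F %% bruun (- s) h)`_k.
  move=> ->; rewrite /c residueE; last by lia.
  by rewrite -ho; congr (_ %% bruun (u _) _)`_ _; lia.
rewrite (aE i j) // (aE (h + i)%N (j + q)%N); last by rewrite jE qE; ring.
rewrite (aE (h + h + i)%N (j + (q + q))%N); last by rewrite jE qE; ring.
rewrite (aE (h + h + h + i)%N (j + (q + q + q))%N); last by rewrite jE qE; ring.
rewrite (c0E i (j + j)%N); last by rewrite jE; ring.
rewrite (c1E i (j + j + 1)%N); last by rewrite jE; ring.
rewrite (c0E (h + i)%N (j + j + (q + q))%N); last by rewrite jE qE; ring.
rewrite (c1E (h + i)%N (j + j + (q + q) + 1)%N); last by rewrite jE qE; ring.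
have [p0 p1] := coef_modp_bruun F s h0 ih.
have [n0 n1] := coef_modp_bruun F (- s) h0 ih.
rewrite sqrrN -hw in n0 n1; rewrite -hw in p0 p1.
rewrite p0 p1 n0 n1 hw; split => //; ring.
Qed.

(** The two children differ only in the sign of s, so their half-sums and their differences divided
    by 2 s recover the parent. *)
Lemma residue_unstep u F q h B j (b := (j %% B)%N)
    (w := u (B + b)%N) (s := u (B + b + (B + b))%N)
    (a := residue u F (h + h) B) (c := residue u F h (B + B))
    (a3 := (c (j + j + 1)%N - c (j + j)%N) / (2 * s))
    (a2 := (c (j + j + (q + q))%N - c (j + j + (q + q) + 1)%N) / (2 * s)) :
  q = (h * B)%N -> root_table q u -> (0 < B)%N -> (j < q)%N ->
  [/\ a j = (c (j + j)%N + c (j + j + 1)%N) / 2 + a2,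
      a (j + q)%N = (c (j + j + (q + q))%N + c (j + j + (q + q) + 1)%N) / 2
                    - (1 + w) * a3,
      a (j + (q + q))%N = a2 & a (j + (q + q + q))%N = a3].
Proof.
move=> qE tu B0 jq; have [c0 c1 c2 c3] := residue_step F qE tu B0 jq.
have bB : (b < B)%N by rewrite ltn_mod.
have Bq : (B <= q)%N.
  rewrite qE leq_pmull //; case: h qE jq {a c a2 a3 c0 c1 c2 c3} => // ->.
  by rewrite mul0n.
have [|_ _ s0] := tu.2 (B + b)%N; first by lia.
rewrite -/s in s0.
have h3 : a (j + (q + q + q))%N = a3.
  by rewrite /a3 /c c0 c1 -/s -/a; field.
have h2 : a (j + (q + q))%N = a2.
  by rewrite /a2 /c c2 c3 -/s -/a -/w; field.
rewrite h2 h3; split=> //.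
  by rewrite /c c0 c1 -/s -/a -/b -/w -h2; field.
by rewrite /c c2 c3 -/s -/a -/b -/w -h3; field.
Qed.

Lemma residue_top u F n j : u 1%N = 0 -> (size F <= n + n)%N ->
  (0 < n)%N -> residue u F n 1 j = F`_j.
Proof.
move=> u1 sF n0; rewrite /residue modn1 divn1 addn0 u1 modp_small //.
by rewrite size_bruun.
Qed.

(** At the leaves the modulus is X^2 - w X + 1: multiply two linear polynomials and replace X^2 by w
    X - 1. *)
Lemma residue_leaf u F G N b (w := u (N + b)%N)
  (f := residue u F 1 N) (g := residue u G 1 N) : (b < N)%N ->
  residue u (F * G) 1 N b = f b * g b - f (b + N)%N * g (b + N)%N /\
  residue u (F * G) 1 N (b + N) =
    f b * g (b + N)%N + f (b + N)%N * g b + w * (f (b + N)%N * g (b + N)%N).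
Proof.
move=> bN.
have e0 H : residue u H 1 N b = (H %% bruun w 1)`_0.
  by rewrite -[b in LHS]/(0 * N + b)%N residueE.
have e1 H : residue u H 1 N (b + N) = (H %% bruun w 1)`_1.
  by rewrite (_ : b + N = 1 * N + b)%N ?residueE //; lia.
rewrite /f /g !e0 !e1; set D := bruun w 1.
have D0 : D != 0 by rewrite -size_poly_gt0 size_bruun.
have lin H : H %% D = ((H %% D)`_0)%:P + ((H %% D)`_1)%:P * 'X.
  apply/polyP => i; rewrite coefD coefC coefCM coefX.
  case: i => [|[|i]] /=; rewrite ?mulr0 ?mulr1 ?addr0 ?add0r //.
  rewrite nth_default //; have := ltn_modpN0 H D0.
  by rewrite size_bruun // ltnS => /leq_trans; apply.
set f0 := (F %% D)`_0; set f1 := (F %% D)`_1.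
set g0 := (G %% D)`_0; set g1 := (G %% D)`_1.
have -> : (F * G) %% D =
    (f0 * g0 - f1 * g1)%:P + (f0 * g1 + f1 * g0 + w * (f1 * g1))%:P * 'X.
  have -> : (F * G) %% D = ((F %% D) * (G %% D)) %% D.
    by rewrite modp_mul [in RHS]mulrC modp_mul mulrC.
  rewrite (lin F) (lin G) -/f0 -/f1 -/g0 -/g1.
  have -> : (f0%:P + f1%:P * 'X) * (g0%:P + g1%:P * 'X) = (f1 * g1)%:P * D +
    ((f0 * g0 - f1 * g1)%:P + (f0 * g1 + f1 * g0 + w * (f1 * g1))%:P * 'X).
    rewrite /D /bruun !rmorphD rmorphN !rmorphM /= addn1 expr1; ring.
  rewrite modp_addl_mul_small // size_bruun //.
  apply: (leq_ltn_trans (size_polyD _ _)); rewrite gtn_max.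
  apply/andP; split; first exact: leq_ltn_trans (size_polyC_leq1 _) _.
  apply: (leq_ltn_trans (size_polyMleq _ _)); rewrite size_polyX.
  by rewrite addn2 /= !ltnS size_polyC_leq1.
by rewrite !coefD !coefC !coefCM !coefX /= !mulr0 !mulr1 addr0 add0r.
Qed.

End Bruun.

(** * The program *)

(* Natural-number variables: 0 holds m, 1 the quarter q of the transform length,
   2 the number B of blocks, 3 the loop counter j, 4 the value j mod B, 5 a
   scratch counter.
   Arrays: 0 eps, 1 alpha, 2 output, 3 scalars (0 error bound, 1 scale N^-K,
   2 counter, 3 factorial), 4 the table of Bruun parameters in heap order,
   5 the current series, 6 and 7 the factors of a product, 8 the target of a
   butterfly, 9 the terms alpha_n rho_n^j / j! of the first series,
   10 the powers of the scale. *)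

Local Notation q1 := (NVar 1).
Local Notation q2 := (NAdd q1 q1).
Local Notation q3 := (NAdd q2 q1).
Local Notation q4 := (NAdd q3 q1).
Local Notation vB := (NVar 2).
Local Notation vj := (NVar 3).
Local Notation vb := (NVar 4).
Local Notation vx := (NVar 5).
Local Notation jj := (NAdd vj vj).

(** Index arithmetic has no division, so j mod B is maintained by increment and wrap-around. *)
Definition next_block : prog :=
  Seq (NSet 4 (NAdd vb (NLit 1))) (If (NLt vb vB) Skip (NSet 4 (NLit 0))).

Definition node : rexp := RGet 4 (NAdd vB vb).
Definition child : rexp := RGet 4 (NAdd (NAdd vB vb) (NAdd vB vb)).

Definition butterfly (a : nat) : prog :=
  let a0 := RGet a vj in let a1 := RGet a (NAdd vj q1) in
  let a2 := RGet a (NAdd vj q2) in let a3 := RGet a (NAdd vj q3) in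
  let d := RSub a0 a2 in let t := RAdd a1 (RMul (RAdd (RLit 1) node) a3) in
  Seq (RSet 8 jj (RSub d (RMul child a3)))
  (Seq (RSet 8 (NAdd jj (NLit 1)) (RAdd d (RMul child a3)))
  (Seq (RSet 8 (NAdd jj q2) (RAdd t (RMul child a2)))
  (Seq (RSet 8 (NAdd (NAdd jj q2) (NLit 1)) (RSub t (RMul child a2)))
   next_block))).

Definition unbutterfly (a : nat) : prog :=
  let c0 := RGet a jj in let c1 := RGet a (NAdd jj (NLit 1)) in
  let c2 := RGet a (NAdd jj q2) in
  let c3 := RGet a (NAdd (NAdd jj q2) (NLit 1)) in
  let s2 := RMul (RLit 2) child in
  let a3 := RDiv (RSub c1 c0) s2 in let a2 := RDiv (RSub c2 c3) s2 in
  Seq (RSet 8 vj (RAdd (RDiv (RAdd c0 c1) (RLit 2)) a2))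
  (Seq (RSet 8 (NAdd vj q1) (RSub (RDiv (RAdd c2 c3) (RLit 2))
                              (RMul (RAdd (RLit 1) node) a3)))
  (Seq (RSet 8 (NAdd vj q2) a2)
  (Seq (RSet 8 (NAdd vj q3) a3)
   next_block))).

Definition pass (body : prog) : prog := Seq (NSet 4 (NLit 0)) (For q1 body).

(** The passes permute indices; writing in place would destroy inputs of later rounds, so results go
    through array 8. *)
Definition copy_back (a : nat) : prog := For q4 (RSet a vj (RGet 8 vj)).

Definition transform (a : nat) : prog :=
  Seq (NSet 2 (NLit 1))
  (While (NLt vB q2)
    (Seq (pass (butterfly a)) (Seq (copy_back a) (NSet 2 (NAdd vB vB))))).

(** Without division, half of B is found by counting. This costs O(B), which stays within the budget
    O(q) of a level. *)
Definition halve : prog :=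
  Seq (NSet 5 (NLit 0))
  (Seq (While (NLt (NAdd vx vx) vB) (NSet 5 (NAdd vx (NLit 1)))) (NSet 2 vx)).

Definition untransform (a : nat) : prog :=
  Seq (NSet 2 q2)
  (While (NLt (NLit 1) vB)
    (Seq halve (Seq (pass (unbutterfly a)) (copy_back a)))).

(** * Correctness and cost of the butterfly passes *)

Section Specs.
Variable R : realType.
Implicit Types (s : state R) (F G : {poly R}).

Lemma exec_seq p1 p2 s : exec (Seq p1 p2) s = exec p2 (exec p1 s).
Proof. by []. Qed.

Lemma cell_set_nvar s x v : cell (set_nvar s x v) = cell s.
Proof. by []. Qed.

(** Each of the four stored values agrees with the target [g] at its own index, so possible
    coincidences between the indices do no harm. *)
Lemma write4 (f g : nat -> R) (x0 x1 x2 x3 : nat) v0 v1 v2 v3 (i : nat) :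
  v0 = g x0 -> v1 = g x1 -> v2 = g x2 -> v3 = g x3 ->
  ([&& i != x0, i != x1, i != x2 & i != x3] -> f i = g i) ->
  (if i == x3 then v3 else if i == x2 then v2 else
   if i == x1 then v1 else if i == x0 then v0 else f i) = g i.
Proof.
move=> h0 h1 h2 h3 h.
do 4! (case: eqP => [->//|/eqP ?]).
by apply: h; apply/and4P.
Qed.

Lemma modSn (k B : nat) : (0 < B)%N ->
  (k.+1 %% B = if (k %% B).+1 < B then (k %% B).+1 else 0)%N.
Proof.
move=> B0; rewrite {1}(divn_eq k B) -addnS modnMDl.
have := ltn_pmod k B0; rewrite leq_eqVlt => /orP[/eqP ->|h].
  by rewrite modnn ltnn.
by rewrite modn_small // h.
Qed.

Lemma exec_next_block s k B : nvar s 4 = (k %% B)%N -> nvar s 2 = B ->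
  (0 < B)%N -> nvar (exec next_block s) 4 = (k.+1 %% B)%N.
Proof.
move=> h4 h2 B0; rewrite /= h4 h2 modSn // addn1.
by case: ifP => /=; rewrite ?addn1 ?h4 ?h2 ?addn1.
Qed.

Lemma cell_next_block s : cell (exec next_block s) = cell s.
Proof. by rewrite /=; case: ifP. Qed.

Lemma even_odd_cover (q : nat) (P : nat -> Prop) :
  (forall k, (k < q)%N -> [/\ P (k + k)%N, P (k + k + 1)%N,
     P (k + k + (q + q))%N & P (k + k + (q + q) + 1)%N]) ->
  forall i, (i < q + q + q + q)%N -> P i.
Proof.
move=> h i hi; have [i2|i2] := ltnP i (q + q)%N.
  have [|h1 h2 _ _] := h i./2; first by lia.
  have [oi|oi] := boolP (odd i).
    by move: h2; congr P; lia.
  by move: h1; congr P; lia.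
have [|_ _ h1 h2] := h (i - (q + q))./2; first by lia.
have [oi|oi] := boolP (odd i).
  by move: h2; congr P; lia.
by move: h1; congr P; lia.
Qed.

Lemma quarter_cover (q : nat) (P : nat -> Prop) :
  (forall k, (k < q)%N -> [/\ P k, P (k + q)%N,
     P (k + (q + q))%N & P (k + (q + q + q))%N]) ->
  forall i, (i < q + q + q + q)%N -> P i.
Proof.
move=> h i hi.
have [i1|i1] := ltnP i q; first by have [] := h i i1.
have [i2|i2] := ltnP i (q + q)%N.
  by have [|_ + _ _] := h (i - q)%N; [lia|congr P; lia].
have [i3|i3] := ltnP i (q + q + q)%N.
  by have [|_ _ + _] := h (i - (q + q))%N; [lia|congr P; lia].
by have [|_ _ _ +] := h (i - (q + q + q))%N; [lia|congr P; lia].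
Qed.

(** The invariant says that variable 4 holds k mod B and that the cells written by rounds before k
    are final; the input array is preserved by the frame condition. *)
Lemma ends_butterfly s (a q h B : nat) F : (a != 8)%N -> (a != 4)%N ->
  nvar s 1 = q -> nvar s 2 = B -> q = (h * B)%N -> (0 < B)%N ->
  root_table q (cell s 4) ->
  (forall i, (i < q + q + q + q)%N ->
     cell s a i = residue (cell s 4) F (h + h) B i) ->
  ends (pass (butterfly a)) s (q * 200 + 20) (fun s' =>
    forall i, (i < q + q + q + q)%N ->
      cell s' 8 i = residue (cell s 4) F h (B + B) i).
Proof.
move=> a8 a4 s1 s2 qE B0 tu ha.
set P := fun (s' : state R) i => cell s' 8 i = residue (cell s 4) F h (B + B) i.
set I := fun k (s' : state R) => nvar s' 4 = (k %% B)%N /\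
  forall k', (k' < k)%N -> [/\ P s' (k' + k')%N, P s' (k' + k' + 1)%N,
    P s' (k' + k' + (q + q))%N & P s' (k' + k' + (q + q) + 1)%N].
apply: ends_mono (_ : ends _ _ (2 + _) (I q)) _ _; first last.
- by move=> s' _ [_ hI]; exact: even_odd_cover.
- shelve.
- apply: (ends_seq (c1 := 2) (Q := fun s' => nvar s' 4 = 0%N)).
    exact: ends_straight.
  move=> s' f0 s'4; apply: (@ends_for _ _ _ _ q) => //.
  + by move=> s'' f; rewrite /= f.1 // f0.1.
  + by move=> s'' f _; split; rewrite ?f.1 ?mod0n.
  move=> k s'' kq f s''3 [s''4 hk].
  have s''1 : nvar s'' 1 = q by rewrite f.1 // f0.1.
  have s''2 : nvar s'' 2 = B by rewrite f.1 // f0.1.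
  have t4 : cell s'' 4 = cell s 4 by rewrite f.2 // f0.2.
  have ta : cell s'' a = cell s a.
    by rewrite f.2 ?f0.2 //= !inE !negb_or a8.
  rewrite /butterfly !exec_seq; split.
    by apply: (@exec_next_block _ k B).
  have [e0 e1 e2 e3] := residue_step F qE tu B0 kq.
  rewrite -!ha in e0 e1 e2 e3; [|lia..].
  move=> k' k'k; rewrite /P !cell_set_nvar !cell_next_block /= !(negPf a8) /=.
  rewrite s''1 s''2 s''3 s''4 ta t4 rmorph1.
  (* An index that avoids the four new writes belongs to an earlier round. *)
  have lt_k' : k' != k -> (k' < k)%N by lia.
  by split; apply: write4 => // /and4P[n0 n1 n2 n3];
    have [] := hk k' (lt_k' _) => //; lia.
Unshelve.
rewrite /pcost /=; lia.
Qed.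

Lemma ends_unbutterfly s (a q h B : nat) F : (a != 8)%N -> (a != 4)%N ->
  nvar s 1 = q -> nvar s 2 = B -> q = (h * B)%N -> (0 < B)%N ->
  root_table q (cell s 4) ->
  (forall i, (i < q + q + q + q)%N ->
     cell s a i = residue (cell s 4) F h (B + B) i) ->
  ends (pass (unbutterfly a)) s (q * 200 + 20) (fun s' =>
    forall i, (i < q + q + q + q)%N ->
      cell s' 8 i = residue (cell s 4) F (h + h) B i).
Proof.
move=> a8 a4 s1 s2 qE B0 tu ha.
set P := fun (s' : state R) i => cell s' 8 i = residue (cell s 4) F (h + h) B i.
set I := fun k (s' : state R) => nvar s' 4 = (k %% B)%N /\
  forall k', (k' < k)%N -> [/\ P s' k', P s' (k' + q)%N,
    P s' (k' + (q + q))%N & P s' (k' + (q + q + q))%N].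
apply: ends_mono (_ : ends _ _ (2 + _) (I q)) _ _; first last.
- by move=> s' _ [_ hI]; exact: quarter_cover.
- shelve.
- apply: (ends_seq (c1 := 2) (Q := fun s' => nvar s' 4 = 0%N)).
    exact: ends_straight.
  move=> s' f0 s'4; apply: (@ends_for _ _ _ _ q) => //.
  + by move=> s'' f; rewrite /= f.1 // f0.1.
  + by move=> s'' f _; split; rewrite ?f.1 ?mod0n.
  move=> k s'' kq f s''3 [s''4 hk].
  have s''1 : nvar s'' 1 = q by rewrite f.1 // f0.1.
  have s''2 : nvar s'' 2 = B by rewrite f.1 // f0.1.
  have t4 : cell s'' 4 = cell s 4 by rewrite f.2 // f0.2.
  have ta : cell s'' a = cell s a.
    by rewrite f.2 ?f0.2 //= !inE !negb_or a8.
  rewrite /unbutterfly !exec_seq; split.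
    by apply: (@exec_next_block _ k B).
  have [e0 e1 e2 e3] := residue_unstep F qE tu B0 kq.
  rewrite -!ha in e0 e1 e2 e3; [|lia..].
  move=> k' k'k; rewrite /P !cell_set_nvar !cell_next_block /= !(negPf a8) /=.
  rewrite s''1 s''2 s''3 s''4 ta t4 rmorph1 rmorph_nat.
  have lt_k' : k' != k -> (k' < k)%N by lia.
  by split; apply: write4 => // /and4P[n0 n1 n2 n3];
    have [] := hk k' (lt_k' _) => //; lia.
Unshelve.
rewrite /pcost /=; lia.
Qed.

Lemma ends_copy_back s (a q : nat) (f : nat -> R) : (a != 8)%N ->
  nvar s 1 = q -> (forall i, (i < q + q + q + q)%N -> cell s 8 i = f i) ->
  ends (copy_back a) s (q * 100 + 20) (fun s' =>
    forall i, (i < q + q + q + q)%N -> cell s' a i = f i).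
Proof.
move=> a8 s1 h8.
apply: ends_mono (_ : ends _ _ _ (fun s' =>
  forall i, (i < q + q + q + q)%N -> cell s' a i = f i)) _ _; first last.
- by [].
- shelve.
- apply: (@ends_for _ _ _ _ _ (fun k s' => forall i, (i < k)%N -> cell s' a i = f i)) => //.
  + by move=> s' fr /=; rewrite !fr.1 // s1.
  move=> k s' kq fr s'3 hk i ik /=; rewrite eqxx s'3 /=.
  case: eqP => [->|ne]; last by apply: hk; lia.
  rewrite fr.2; first exact: h8.
  by rewrite /= inE eq_sym.
Unshelve.
rewrite /pcost /=; lia.
Qed.

End Specs.

(** * Products of truncated power series *)

Local Notation m1 := (NAdd (NVar 0) (NLit 1)).

(** The new constant coefficient waits in array 8, because the old one still enters the linear
    coefficient. *)
Definition leaf_products : prog :=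
  let f0 := RGet 6 vj in let f1 := RGet 6 (NAdd vj q2) in
  let g0 := RGet 7 vj in let g1 := RGet 7 (NAdd vj q2) in
  For q2
    (Seq (RSet 8 vj (RSub (RMul f0 g0) (RMul f1 g1)))
    (Seq (RSet 6 (NAdd vj q2) (RAdd (RAdd (RMul f0 g1) (RMul f1 g0))
                                (RMul (RGet 4 (NAdd q2 vj)) (RMul f1 g1))))
         (RSet 6 vj (RGet 8 vj)))).

(** The factors are g(t) and g(z t), padded with zeros to length 4 q; the power of z is accumulated
    in array 10. *)
Definition load : prog :=
  Seq (For q4 (Seq (RSet 6 vj (RLit 0)) (RSet 7 vj (RLit 0))))
  (Seq (RSet 10 (NLit 0) (RLit 1))
  (For m1
    (Seq (RSet 6 vj (RGet 5 vj))
    (Seq (RSet 7 vj (RMul (RGet 5 vj) (RGet 10 (NLit 0))))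
         (RSet 10 (NLit 0) (RMul (RGet 10 (NLit 0)) (RGet 3 (NLit 1)))))))).

Definition store : prog := For m1 (RSet 5 vj (RGet 6 vj)).

Definition convolve : prog :=
  Seq load (Seq (transform 6) (Seq (transform 7)
  (Seq leaf_products (Seq (untransform 6) store)))).

Section Specs.
Variable R : realType.
Implicit Types (s : state R) (F G : {poly R}).

(** After k levels B = 2^k and the moduli have M = 2^(l + 1 - k). There are l + 1 levels, each of
    cost O(q). *)
Lemma ends_transform s (a l : nat) F (q := (2 ^ l)%N) : (a != 8)%N -> (a != 4)%N ->
  nvar s 1 = q -> root_table q (cell s 4) -> (size F <= q + q + q + q)%N ->
  (forall i, (i < q + q + q + q)%N -> cell s a i = F`_i) ->
  ends (transform a) s (l.+1 * (q * 400)) (fun s' =>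
    forall i, (i < q + q + q + q)%N ->
      cell s' a i = residue (cell s 4) F 1 (q + q) i).
Proof.
move=> a8 a4 s1 tu sF ha; set u := cell s 4.
have q0 : (0 < q)%N by rewrite expn_gt0.
have q2E : (q + q = 2 ^ l.+1)%N by rewrite expnS mul2n addnn.
set I := fun k (s' : state R) => nvar s' 2 = (2 ^ k)%N /\
  forall i, (i < q + q + q + q)%N ->
    cell s' a i = residue u F (2 ^ (l.+1 - k)) (2 ^ k) i.
apply: ends_mono (_ : ends _ _ (2 + _) (I l.+1)) _ _; first last.
- by move=> s' _ [_ hI] i hi; rewrite hI // subnn expn0 q2E.
- shelve.
- apply: (ends_seq (c1 := 2) (Q := fun s' => nvar s' 2 = 1%N)).
    exact: ends_straight.
  move=> s' f0 s'2; apply: (@ends_while _ _ _ _ (q * 200 + 20 + (q * 100 + 20 + 4))).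
  + split=> // i hi; rewrite subn0 expn0 -q2E (residue_top _ tu.1) ?addnA //.
      by rewrite f0.2 // ha.
    by rewrite addn_gt0 q0.
  + move=> k s'' kl f [s''2 _] /=.
    by rewrite s''2 f.1 // f0.1 // s1 q2E ltn_exp2l.
  move=> k s'' kl f [s''2 hk].
  have s''1 : nvar s'' 1 = q by rewrite f.1 // f0.1.
  have t4 : cell s'' 4 = u.
    by rewrite f.2 ?f0.2 //= !inE (eq_sym 4%N a) (negPf a4).
  have [kl1 kl2] : (l.+1 - k = (l - k).+1)%N /\ (k <= l)%N by lia.
  apply: ends_seq (ends_butterfly a8 a4 s''1 s''2 (h := 2 ^ (l - k)) (F := F) _ _ _ _) _.
  + by rewrite -expnD subnK.
  + by rewrite expn_gt0.
  + by rewrite t4.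
  + by move=> i hi; rewrite t4 hk // kl1 expnS mul2n addnn.
  move=> s3 f3 hs3.
  apply: ends_seq (ends_copy_back a8 _ hs3) _; first by rewrite f3.1.
  move=> s4 f4 hs4; apply: ends_straight => //; split.
    by rewrite /= f4.1 // f3.1 // s''2 expnS mul2n addnn.
  move=> i hi; rewrite /= hs4 // t4 subSS expnS mul2n addnn //.
Unshelve.
rewrite /tcost /ncost; clear -q0; nia.
Qed.

Lemma ends_halve s (B : nat) : nvar s 2 = (B + B)%N ->
  ends halve s (B * 10 + 20) (fun s' => nvar s' 2 = B).
Proof.
move=> s2; apply: ends_mono (_ : ends _ _ (2 + (B * (5 + 4) + 5 + 2)) _) _ _; first last.
- by move=> s' _; exact: id.
- lia.
- apply: (ends_seq (c1 := 2) (Q := fun s' => nvar s' 5 = 0%N)).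
    exact: ends_straight.
  move=> s1 f1 s1x.
  apply: (ends_seq (Q := fun s' => nvar s' 5 = B)).
    apply: (@ends_while _ _ _ _ 4 B (fun k s' => nvar s' 5 = k)) => //.
      move=> k s' kB f s'5 /=; rewrite s'5 f.1 // f1.1 // s2.
      by apply/idP/idP; lia.
    move=> k s' kB f s'5; apply: ends_straight => //=.
    by rewrite s'5 addn1.
  by move=> s3 f3 s3x; apply: ends_straight.
Qed.

(** The levels are traversed backwards; B is halved before the pass because [unbutterfly] is indexed
    by the parent level. *)
Lemma ends_untransform s (a l : nat) F (q := (2 ^ l)%N) : (a != 8)%N -> (a != 4)%N ->
  nvar s 1 = q -> root_table q (cell s 4) -> (size F <= q + q + q + q)%N ->
  (forall i, (i < q + q + q + q)%N ->
    cell s a i = residue (cell s 4) F 1 (q + q) i) ->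
  ends (untransform a) s (l.+1 * (q * 500)) (fun s' =>
    forall i, (i < q + q + q + q)%N -> cell s' a i = F`_i).
Proof.
move=> a8 a4 s1 tu sF ha; set u := cell s 4.
have q0 : (0 < q)%N by rewrite expn_gt0.
have q2E : (q + q = 2 ^ l.+1)%N by rewrite expnS mul2n addnn.
set I := fun k (s' : state R) => nvar s' 2 = (2 ^ (l.+1 - k))%N /\
  forall i, (i < q + q + q + q)%N ->
    cell s' a i = residue u F (2 ^ k) (2 ^ (l.+1 - k)) i.
apply: ends_mono (_ : ends _ _ (4 + _) (I l.+1)) _ _; first last.
- move=> s' _ [_ hI] i hi; rewrite hI // subnn expn0 -q2E (residue_top _ tu.1) ?addnA //.
  by rewrite addn_gt0 q0.
- shelve.
- apply: (ends_seq (c1 := 4) (Q := fun s' => nvar s' 2 = (q + q)%N)).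
    by apply: ends_straight => //=; rewrite s1.
  move=> s' f0 s'2; apply: (@ends_while _ _ _ _
      (q * 10 + 20 + (q * 200 + 20 + (q * 100 + 20)))).
  + split; first by rewrite subn0 -q2E.
    by move=> i hi; rewrite subn0 expn0 -q2E f0.2 // ha.
  + move=> k s'' kl f [s''2 _] /=.
    by rewrite s''2 -(expn0 2) ltn_exp2l // subn_gt0.
  move=> k s'' kl f [s''2 hk].
  have s''1 : nvar s'' 1 = q by rewrite f.1 // f0.1.
  have t4 : cell s'' 4 = u.
    by rewrite f.2 ?f0.2 //= !inE (eq_sym 4%N a) (negPf a4).
  have [kl1 kl2] : (l.+1 - k = (l - k).+1)%N /\ (k <= l)%N by lia.
  apply: (ends_seq (Q := fun s' => nvar s' 2 = (2 ^ (l - k))%N)).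
    apply: ends_mono (ends_halve (B := 2 ^ (l - k)) _) _ _.
    + by rewrite s''2 kl1 expnS mul2n addnn.
    + by rewrite leq_add2r leq_mul2r /= leq_exp2l // leq_subr.
    by [].
  move=> s3 f3 s32.
  have t43 : cell s3 4 = u by rewrite f3.2.
  apply: ends_seq (ends_unbutterfly a8 a4 _ s32 (q := q) (h := 2 ^ k) (F := F) _ _ _ _) _.
  + by rewrite f3.1.
  + by rewrite -expnD subnKC.
  + by rewrite expn_gt0.
  + by rewrite t43.
  + move=> i hi; rewrite t43 f3.2 // hk // kl1 expnS mul2n addnn //.
  move=> s4 f4 hs4.
  apply: ends_mono (ends_copy_back a8 (q := q) _ hs4) _ _ => //.
    by rewrite f4.1 // f3.1.
  move=> s5 f5 hs5; split.
    by rewrite f5.1 // f4.1 // s32 subSS.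
  by move=> i hi; rewrite hs5 // t43 subSS expnS mul2n addnn.
Unshelve.
rewrite /tcost /ncost; clear -q0; nia.
Qed.

Lemma ends_leaf_products s (q : nat) F G : nvar s 1 = q ->
  (forall i, (i < q + q + q + q)%N ->
    cell s 6 i = residue (cell s 4) F 1 (q + q) i /\
    cell s 7 i = residue (cell s 4) G 1 (q + q) i) ->
  ends leaf_products s (q * 200 + 20) (fun s' =>
    forall i, (i < q + q + q + q)%N ->
      cell s' 6 i = residue (cell s 4) (F * G) 1 (q + q) i).
Proof.
move=> s1 hFG.
set P := fun (s' : state R) i =>
  cell s' 6 i = residue (cell s 4) (F * G) 1 (q + q) i.
apply: ends_mono (_ : ends _ _ _ (fun s' => forall b, (b < q + q)%N ->
    P s' b /\ P s' (b + (q + q))%N)) _ _; first last.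
- move=> s' _ h i hi; have [i2|i2] := ltnP i (q + q)%N; first by case: (h i i2).
  have [|_ +] := h (i - (q + q))%N; first lia.
  by rewrite /P subnK.
- shelve.
(* Array 6 is updated in place, so the invariant also records that the entries of pending rounds are
   still the original ones. *)
- apply: ends_mono (@ends_for _ _ _ _ (q + q) (fun k s' =>
    forall b, (b < q + q)%N ->
      if (b < k)%N then P s' b /\ P s' (b + (q + q))%N
      else cell s' 6 b = cell s 6 b /\
           cell s' 6 (b + (q + q)) = cell s 6 (b + (q + q))) _ _ _ _ _) _ _ => //.
  + by move=> s' f; rewrite /= f.1 // s1.
  + by move=> s' f s'3 b bq; rewrite f.2.
  + move=> k s' kq f s'3 hk b bq.
    have s'1 : nvar s' 1 = q by rewrite f.1.
    have t4 : cell s' 4 = cell s 4 by rewrite f.2.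
    have t7 : cell s' 7 = cell s 7 by rewrite f.2.
    have [L0 L1] := residue_leaf (cell s 4) F G kq.
    have := hk k kq; rewrite ltnn => -[k0 k1].
    have [kF kG] := hFG k ltac:(lia).
    have [kF' kG'] := hFG (k + (q + q))%N ltac:(lia).
    have := hk b bq; rewrite /P /= !s'3 !s'1 t4 t7 !eqxx /= k0 k1 kF kG kF' kG'.
    rewrite ltnS; case: (ltngtP b k) => [bk|bk|->] [b0 b1].
    - rewrite !ifF; [by []|lia..].
    - rewrite !ifF; [by []|lia..].
    rewrite !eqxx /= ifF ?eqxx; last lia.
    by rewrite L0 L1.
  + by move=> s' _ h b bq; have := h b bq; rewrite bq.
Unshelve.
rewrite /=; lia.
Qed.
End Specs.

Section Specs.
Variable R : realType.
Implicit Types (s : state R) (F G : {poly R}).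

Lemma ends_load s (m q : nat) (g := cell s 5) (z := cell s 3 1) :
  nvar s 0 = m -> nvar s 1 = q -> (m < q + q + q + q)%N ->
  ends load s (q * 400 + 50) (fun s' =>
    forall i, (i < q + q + q + q)%N ->
      cell s' 6 i = (\poly_(i < m.+1) g i)`_i /\
      cell s' 7 i = (\poly_(i < m.+1) (g i * z ^+ i))`_i).
Proof.
move=> s0 s1 mq.
pose I0 k (s' : state R) := forall i, (i < k)%N -> cell s' 6 i = 0 /\ cell s' 7 i = 0.
apply: ends_mono (ends_seq (@ends_for _ _ _ _ (q + q + q + q) I0 _ _ _ _ _)
  (c2 := 3 + (m.+1 * 30 + 10)) (Q' := fun s' =>
    forall i, (i < q + q + q + q)%N ->
      cell s' 6 i = (if (i < m.+1)%N then g i else 0) /\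
      cell s' 7 i = (if (i < m.+1)%N then g i * z ^+ i else 0)) _) _ _ => //.
- by move=> s' f; rewrite /= f.1 // s1.
- move=> k s' kq f s'3 hk i ik; rewrite /= s'3 rmorph0.
  by case: eqP => [//|ne]; apply: hk; lia.
- shelve.
- by rewrite /=; lia.
- by move=> s' _ h i hi; rewrite !coef_poly; exact: h.
Unshelve.
move=> s2 f2 h2.
apply: (ends_seq (Q := fun s' => cell s' 10 0 = 1 /\ cell s' 3 1 = z /\
    cell s' 6 = cell s2 6 /\ cell s' 7 = cell s2 7)).
  by apply: ends_straight => //=; rewrite rmorph1 f2.2.
move=> s3 f3 [h30 [h31 [h36 h37]]].
pose I k (s' : state R) := [/\ cell s' 3 1 = z, cell s' 10 0 = z ^+ k &
  forall i, (i < q + q + q + q)%N ->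
      cell s' 6 i = (if (i < k)%N then g i else 0) /\
      cell s' 7 i = (if (i < k)%N then g i * z ^+ i else 0)].
apply: ends_mono (@ends_for _ _ _ _ m.+1 I _ _ _ _ _) _ _ => //.
- by move=> s' f; rewrite /= f.1 // f3.1 // f2.1 // s0 addn1.
- move=> s' f _; rewrite /I !f.2 // h30 h31 h36 h37 expr0.
  by split=> // i hi; rewrite ltn0; exact: h2.
- move=> k s' km f s'3 [k1 k2 hk].
  have g5 : cell s' 5 = g by rewrite f.2 // f3.2 // f2.2.
  rewrite /I /= !s'3 k1 k2 g5 exprSr; split=> // i hi; rewrite ltnS.
  case: (ltngtP i k) => [ik|ik|->].
  + by rewrite (hk i hi).1 (hk i hi).2 ik.
  + by rewrite (hk i hi).1 (hk i hi).2 ltnNge ltnW.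
  by [].
- by rewrite /=; lia.
- by move=> s' _ [].
Qed.

Lemma ends_store s (m : nat) (f : nat -> R) :
  nvar s 0 = m -> (forall i, (i <= m)%N -> cell s 6 i = f i) ->
  ends store s (m * 20 + 40) (fun s' =>
    forall i, (i <= m)%N -> cell s' 5 i = f i).
Proof.
move=> s0 h6; apply: ends_mono (@ends_for _ _ _ _ m.+1 (fun k s' =>
  forall i, (i < k)%N -> cell s' 5 i = f i) _ _ _ _ _) _ _ => //.
- by move=> s' fr; rewrite /= fr.1 // s0 addn1.
- move=> k s' km fr s'3 hk i ik; rewrite /= s'3 fr.2 //.
  by case: eqP => [->|ne]; [exact: h6|apply: hk; lia].
- rewrite /=; lia.
Qed.

(** The product has degree at most 2 m < 4 q, so reduction modulo X^(4q) + 1 leaves it unchanged;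
    only its first m + 1 coefficients are kept. *)
Lemma ends_convolve s (m l : nat) (q := (2 ^ l)%N) (g := cell s 5) (z := cell s 3 1) :
  nvar s 0 = m -> nvar s 1 = q -> (m + m + 2 <= q + q + q + q)%N ->
  root_table q (cell s 4) ->
  ends convolve s (l.+1 * (q * 3000)) (fun s' =>
    forall i, (i <= m)%N ->
      cell s' 5 i = \sum_(k < i.+1) g k * (g (i - k)%N * z ^+ (i - k))).
Proof.
move=> s0 s1 mq tu.
have q0 : (0 < q)%N by rewrite expn_gt0.
set F := \poly_(i < m.+1) g i; set G := \poly_(i < m.+1) (g i * z ^+ i).
have sF : (size F <= m.+1)%N by exact: size_poly.
have sG : (size G <= m.+1)%N by exact: size_poly.
have mq' : (m.+1 <= q + q + q + q)%N by lia.
have sFG : (size (F * G)%R <= q + q + q + q)%N.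
  apply: leq_trans (size_polyMleq _ _) _; rewrite -ltnS.
  by apply: leq_ltn_trans (leq_pred _) _;
    apply: leq_ltn_trans (leq_add sF sG) _; rewrite ltnS; lia.
apply: ends_mono (_ : ends _ _ (_ + (_ + (_ + (_ + (_ + _))))) _) _ _; first last.
- by move=> s' _; exact: id.
- shelve.
apply: ends_seq (ends_load s0 s1 _) _; first lia.
rewrite -/g -/z -/F -/G => s2 f2 h2.
have t2 : cell s2 4 = cell s 4 by rewrite f2.2.
apply: ends_seq (ends_transform (l := l) (F := F) _ _ _ _ _ _) _ => //.
- by rewrite f2.1.
- by rewrite t2.
- by rewrite (leq_trans sF).
- by move=> i hi; exact: (h2 i hi).1.
rewrite -/q t2 => s3 f3 h3.
have t3 : cell s3 4 = cell s 4 by rewrite f3.2 // t2.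
apply: ends_seq (ends_transform (l := l) (F := G) _ _ _ _ _ _) _ => //.
- by rewrite f3.1 // f2.1.
- by rewrite t3.
- by rewrite (leq_trans sG).
- by move=> i hi; rewrite f3.2 //; exact: (h2 i hi).2.
rewrite -/q t3 => s4 f4 h4.
have t4 : cell s4 4 = cell s 4 by rewrite f4.2 // t3.
apply: ends_seq (ends_leaf_products (q := q) (F := F) (G := G) _ _) _ => //.
- by rewrite f4.1 // f3.1 // f2.1.
- by move=> i hi; rewrite t4 h4 // f4.2 // h3.
rewrite t4 => s5 f5 h5.
have t5 : cell s5 4 = cell s 4 by rewrite f5.2 // t4.
apply: ends_seq (ends_untransform (l := l) (F := F * G) _ _ _ _ _ _) _ => //.
- by rewrite f5.1 // f4.1 // f3.1 // f2.1.
- by rewrite t5.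
- by move=> i hi; rewrite t5 h5.
rewrite -/q => s6 f6 h6; apply: ends_store.
  by rewrite f6.1 // f5.1 // f4.1 // f3.1 // f2.1.
move=> i im; rewrite h6; last lia.
rewrite coefM; apply: eq_bigr => k _; have := ltn_ord k => ki.
by rewrite !coef_poly !ifT //; lia.
Unshelve.
have : (m <= q + q)%N by lia.
clear -q0; nia.
Qed.
End Specs.

(** * The complete moment program *)

Local Notation vj1 := (NAdd vj (NLit 1)).

Definition choose_size : prog :=
  Seq (NSet 1 (NLit 1))
      (While (NLt q4 (NAdd (NAdd (NVar 0) (NVar 0)) (NLit 2))) (NSet 1 q2)).

Definition table_body : prog :=
  Seq (RSet 4 (NAdd vj1 vj1) (RSqrt (RAdd (RLit 2) (RGet 4 vj1))))
      (RSet 4 (NAdd (NAdd vj1 vj1) (NLit 1))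
         (RSub (RLit 0) (RGet 4 (NAdd vj1 vj1)))).

(** The round with counter k fills in the children of node k + 1, so 2 q - 1 rounds serve the nodes
    1, ..., 2 q - 1. *)
Definition fill_table : prog :=
  Seq (RSet 4 (NLit 1) (RLit 0))
      (For (NSub q2 (NLit 1)) table_body).

(** N is a constant of the program, so loops over the weights are unrolled into syntax and their
    cost goes into the implied constant. *)
Fixpoint init_terms (n : nat) : prog :=
  if n is n'.+1 then Seq (init_terms n') (RSet 9 (NLit n') (RGet 1 (NLit n')))
  else Skip.

Fixpoint sum_terms (n : nat) : rexp :=
  if n is n'.+1 then RAdd (sum_terms n') (RGet 9 (NLit n')) else RLit 0.

Fixpoint next_terms (rho : nat -> rat) (n : nat) : prog :=
  if n is n'.+1 then
    Seq (next_terms rho n')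
        (RSet 9 (NLit n') (RDiv (RMul (RGet 9 (NLit n')) (RLit (rho n')))
                                (RGet 3 (NLit 2))))
  else Skip.

Definition coefficient_body (rho : nat -> rat) (N : nat) : prog :=
  Seq (RSet 5 vj (sum_terms N))
  (Seq (RSet 3 (NLit 2) (RAdd (RGet 3 (NLit 2)) (RLit 1)))
       (next_terms rho N)).

Definition coefficients (rho : nat -> rat) (N : nat) : prog :=
  Seq (init_terms N)
  (Seq (RSet 3 (NLit 2) (RLit 0)) (For m1 (coefficient_body rho N))).

(** Error bound and scale are squared each round, in step with the doubling of the number of factors
    by [convolve]. *)
Definition doubling_loop (e z : rat) : prog :=
  Seq (RSet 3 (NLit 0) (RLit e))
  (Seq (RSet 3 (NLit 1) (RLit z))
  (While (RLt (RGet 0 (NLit 0)) (RGet 3 (NLit 0)))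
    (Seq convolve
    (Seq (RSet 3 (NLit 0) (RMul (RGet 3 (NLit 0)) (RGet 3 (NLit 0))))
         (RSet 3 (NLit 1) (RMul (RGet 3 (NLit 1)) (RGet 3 (NLit 1)))))))).

Definition output : prog :=
  Seq (RSet 3 (NLit 2) (RLit 0))
  (Seq (RSet 3 (NLit 3) (RLit 1))
  (For m1
    (Seq (RSet 2 vj (RMul (RGet 5 vj) (RGet 3 (NLit 3))))
    (Seq (RSet 3 (NLit 2) (RAdd (RGet 3 (NLit 2)) (RLit 1)))
         (RSet 3 (NLit 3) (RMul (RGet 3 (NLit 3)) (RGet 3 (NLit 2)))))))).

Definition moment_program (rho : nat -> rat) (N : nat) (e z : rat) : prog :=
  Seq choose_size (Seq fill_table (Seq (coefficients rho N)
  (Seq (doubling_loop e z) output))).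

(** These are the coefficients of prod_(k < 2^r) G (z^k t), where G is the series with coefficients
    [g]. *)
Fixpoint doubling (R : realType) (g : nat -> R) (z : R) (r : nat) : nat -> R :=
  if r is r'.+1 then fun j => \sum_(k < j.+1) doubling g z r' k *
    (doubling g z r' (j - k)%N * (z ^+ (2 ^ r')) ^+ (j - k))
  else g.

Section Specs.
Variable R : realType.
Implicit Types s : state R.

Lemma ends_choose_size s (m l : nat) : nvar s 0 = m ->
  (m + m + 2 <= 4 * 2 ^ l)%N ->
  (forall k, (k < l)%N -> (4 * 2 ^ k < m + m + 2)%N) ->
  ends choose_size s (l * 20 + 20) (fun s' => nvar s' 1 = (2 ^ l)%N).
Proof.
move=> s0 hl hk.
apply: ends_mono (_ : ends _ _ (2 + (l * (13 + 4) + 13)) _) _ _; first last.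
- by move=> s' _; exact: id.
- lia.
apply: (ends_seq (c1 := 2) (Q := fun s' => nvar s' 1 = 1%N)).
  exact: ends_straight.
move=> s1 f1 s11.
apply: (@ends_while _ _ _ _ 4 l (fun k s' => nvar s' 1 = (2 ^ k)%N)) => //.
- move=> k s' kl f s'1; rewrite /= s'1 f.1 // f1.1 // s0.
  move: kl; rewrite leq_eqVlt => /orP[/eqP ->|kl]; first by rewrite ltnn; lia.
  by rewrite kl; have := hk k kl; lia.
- move=> k s' kl f s'1; apply: ends_straight => //=.
  by rewrite s'1 expnS mul2n addnn.
Qed.

(** The strict bound |u| < 2 is part of the invariant: it makes 2 + u positive, so the square root
    is nonzero, and it passes to sqrt (2 + u). *)
Lemma ends_fill_table s (q : nat) : nvar s 1 = q ->
  ends fill_table s (q * 100 + 50) (fun s' => root_table q (cell s' 4)).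
Proof.
move=> s1.
pose I k (s' : state R) := [/\ cell s' 4 1 = 0,
  (forall i, (0 < i < k.+1 + k.+1)%N -> `|cell s' 4 i| < 2) &
  forall b, (0 < b < k.+1)%N ->
    [/\ cell s' 4 (b + b) ^+ 2 = 2 + cell s' 4 b,
        cell s' 4 (b + b + 1) = - cell s' 4 (b + b) & cell s' 4 (b + b) != 0]].
apply: ends_mono (_ : ends _ _ (_ + _) (I (q + q - 1)%N)) _ _; first last.
- move=> s' _ [h1 _ h2]; split=> // b hb; apply: h2; lia.
- shelve.
apply: (ends_seq (Q := fun s' => cell s' 4 1 = 0)).
  by apply: ends_straight => //=; rewrite rmorph0.
move=> s2 f2 h2; apply: (@ends_for _ _ _ _ (q + q - 1)%N I) => //.
- by move=> s' f; rewrite /= f.1 // f2.1 // s1.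
- move=> s' f _; split; rewrite ?f.2 //; last by move=> b; lia.
  by move=> i hi; rewrite (_ : i = 1%N) ?h2 ?normr0 //; lia.
move=> k s' kq f s'3 [k1 k2 k3].
set v := Num.sqrt (2 + cell s' 4 k.+1).
have /andP[lo hi] : -2 < cell s' 4 k.+1 < 2.
  by rewrite -ltr_norml; apply: k2; lia.
have v0 : 0 < v by rewrite sqrtr_gt0; lra.
have vE : v ^+ 2 = 2 + cell s' 4 k.+1 by rewrite sqr_sqrtr //; lra.
have v2 : v < 2 by nra.
have E i : cell (exec table_body s') 4 i =
    if (i == k.+1 + k.+1 + 1)%N then - v else
    if (i == k.+1 + k.+1)%N then v else cell s' 4 i.
  by rewrite /= s'3 !addn1 eqxx rmorph0 rmorph_nat sub0r.
have Eo i : (i < k.+1 + k.+1)%N -> cell (set_nvar (exec table_body s') 3 k.+1) 4 i = cell s' 4 i.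
  by move=> ik; rewrite cell_set_nvar E !ifF //; lia.
split.
- by rewrite Eo //; lia.
- move=> i hi'; rewrite cell_set_nvar E.
  case: eqP => [_|i1]; first by rewrite normrN gtr0_norm.
  case: eqP => [_|i2]; first by rewrite gtr0_norm.
  by apply: k2; lia.
move=> b hb; have [bk|bk] := ltnP b k.+1.
  have [|b1 b2 b3] := k3 b; first by lia.
  by rewrite !Eo //; lia.
have -> : b = k.+1 by lia.
rewrite (Eo k.+1); last by lia.
rewrite !cell_set_nvar !E !eqxx.
rewrite (_ : (k.+1 + k.+1 == k.+1 + k.+1 + 1)%N = false); last by lia.
by split; rewrite ?vE // gt_eqF.
Unshelve.
rewrite /=; lia.
Qed.

Lemma straight_init_terms n : straight (init_terms n).
Proof. by elim: n => //= n ->. Qed.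

Lemma straight_next_terms rho n : straight (next_terms rho n).
Proof. by elim: n => //= n ->. Qed.

Lemma nwrites_init_terms n : nwrites (init_terms n) = [::].
Proof. by elim: n => //= n ->. Qed.

Lemma nwrites_next_terms rho n : nwrites (next_terms rho n) = [::].
Proof. by elim: n => //= n ->. Qed.

Lemma awrites_init_terms n a : a != 9%N -> a \notin awrites (init_terms n).
Proof. by move=> h; elim: n => //= n IH; rewrite mem_cat inE negb_or IH. Qed.

Lemma awrites_next_terms rho n a : a != 9%N -> a \notin awrites (next_terms rho n).
Proof. by move=> h; elim: n => //= n IH; rewrite mem_cat inE negb_or IH. Qed.

Lemma exec_init_terms n s i : (i < n)%N ->
  cell (exec (init_terms n) s) 9 i = cell s 1 i.
Proof.
elim: n => // n IH; rewrite ltnS leq_eqVlt => /orP[/eqP ->|h] /=.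
  rewrite eqxx (exec_frame _ (straight_init_terms n)).2 //.
  exact: awrites_init_terms.
by rewrite (ltn_eqF h) IH.
Qed.

Lemma exec_next_terms rho n s i :
  cell (exec (next_terms rho n) s) 9 i =
  if (i < n)%N then cell s 9 i * ratr (rho i) / cell s 3 2 else cell s 9 i.
Proof.
elim: n i => //= n IH i; rewrite ltnS.
have -> : cell (exec (next_terms rho n) s) 3 = cell s 3.
  apply: (exec_frame _ (straight_next_terms rho n)).2.
  exact: awrites_next_terms.
by case: (ltngtP i n) => [h|h|->]; rewrite !IH ?ltnn ?h // ltnNge ltnW.
Qed.

Lemma reval_sum_terms n s : reval s (sum_terms n) = \sum_(d < n) cell s 9 d.
Proof.
elim: n => [|n IH] /=; first by rewrite rmorph0 big_ord0.
by rewrite big_ord_recr /= IH.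
Qed.

Lemma ends_coefficients s (rho : nat -> rat) (N m : nat) : nvar s 0 = m ->
  ends (coefficients rho N) s
    (m.+1 * (pcost (init_terms N) + pcost (coefficient_body rho N) + 50))
    (fun s' => forall j, (j <= m)%N ->
       cell s' 5 j = \sum_(d < N) cell s 1 d * ratr (rho d) ^+ j / j`!%:R).
Proof.
move=> s0.
pose I k (s' : state R) := [/\ cell s' 3 2 = k%:R,
  (forall d, (d < N)%N -> cell s' 9 d = cell s 1 d * ratr (rho d) ^+ k / k`!%:R) &
  forall j, (j < k)%N ->
    cell s' 5 j = \sum_(d < N) cell s 1 d * ratr (rho d) ^+ j / j`!%:R].
apply: ends_mono (_ : ends _ _ (pcost (init_terms N) + (_ + _)) (I m.+1)) _ _; first last.
- by move=> s' _ [_ _ h].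
- shelve.
apply: (ends_seq (Q := fun s' => forall d, (d < N)%N -> cell s' 9 d = cell s 1 d)).
  apply: ends_straight; first exact: straight_init_terms.
  by move=> d dN; exact: exec_init_terms.
move=> s2 f2 h2.
have s20 : nvar s2 0 = m by rewrite f2.1 ?nwrites_init_terms.
apply: (ends_seq (Q := fun s' => cell s' 3 2 = 0 /\ cell s' 9 = cell s2 9)).
  by apply: ends_straight => //=; rewrite rmorph0.
move=> s3 f3 [h31 h32]; apply: (@ends_for _ _ _ _ m.+1 I).
- by rewrite /= straight_next_terms.
- by rewrite /= nwrites_next_terms.
- move=> s' f; rewrite /= f.1 ?f3.1 ?s20 ?addn1 //.
  by rewrite /= nwrites_next_terms.
- move=> s' f _; split; rewrite ?f.2 // => d dN.
  by rewrite h32 h2 // expr0 mulr1 fact0 divr1.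
move=> k s' km f s'3 [k1 k2 k3].
rewrite /coefficient_body !exec_seq.
have fr (st : state R) : frame (next_terms rho N) st (exec (next_terms rho N) st).
  exact: exec_frame (straight_next_terms rho N).
split.
- rewrite cell_set_nvar (fr _).2; last exact: awrites_next_terms.
  by rewrite /= rmorph1 k1 -natr1.
- move=> d dN; rewrite cell_set_nvar exec_next_terms dN /= rmorph1 k1 natr1.
  rewrite k2 // exprSr factS natrM invfM; ring.
move=> j jk; rewrite cell_set_nvar (fr _).2; last exact: awrites_next_terms.
rewrite /= s'3; case: eqP => [->|ne]; last by apply: k3; lia.
by rewrite reval_sum_terms; apply: eq_bigr => d _; rewrite k2.
Unshelve.
move: (pcost (init_terms N)) (pcost (coefficient_body rho N)) => a b.
rewrite /=; nia.
Qed.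

Lemma ends_doubling_loop s (m l r : nat) (e z : rat) (q := (2 ^ l)%N)
    (g := cell s 5) :
  nvar s 0 = m -> nvar s 1 = q -> (m + m + 2 <= q + q + q + q)%N ->
  root_table q (cell s 4) ->
  ratr e ^+ (2 ^ r) <= cell s 0 0 ->
  (forall k, (k < r)%N -> cell s 0 0 < ratr e ^+ (2 ^ k)) ->
  ends (doubling_loop e z) s (r * (l.+1 * (q * 4000)) + 20) (fun s' =>
    forall i, (i <= m)%N -> cell s' 5 i = doubling g (ratr z) r i).
Proof.
move=> s0 s1 mq tu er ek.
have q0 : (0 < q)%N by rewrite expn_gt0.
pose I k (s' : state R) := [/\ cell s' 3 0 = ratr e ^+ (2 ^ k),
  cell s' 3 1 = ratr z ^+ (2 ^ k) &
  forall i, (i <= m)%N -> cell s' 5 i = doubling g (ratr z) k i].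
apply: ends_mono (_ : ends _ _ (3 + (3 + _)) (I r)) _ _; first last.
- by move=> s' _ [].
- shelve.
apply: (ends_seq (Q := fun s' => cell s' 3 0 = ratr e)).
  exact: ends_straight.
move=> s2 f2 h2.
apply: (ends_seq (Q := fun s' => cell s' 3 0 = ratr e /\ cell s' 3 1 = ratr z)).
  exact: ends_straight.
move=> s3 f3 [h3 h3'].
apply: (@ends_while _ _ _ _ (l.+1 * (q * 3000) + (7 + 7)) r I).
- by split; rewrite ?expn0 ?expr1 // => i im; rewrite f3.2 // f2.2.
- move=> k s' kr f [k1 _ _]; rewrite /= k1 f.2 // f3.2 // f2.2 //.
  move: kr; rewrite leq_eqVlt => /orP[/eqP ->|kr].
    by rewrite ltnn ltNge er.
  by rewrite kr ek.
move=> k s' kr f [k1 k2 k3].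
apply: ends_seq (ends_convolve (m := m) (l := l) _ _ _ _) _ => //.
- by rewrite f.1 // f3.1 // f2.1.
- by rewrite f.1 // f3.1 // f2.1.
- by rewrite f.2 // f3.2 // f2.2.
move=> s4 f4 h4; apply: ends_straight => //; split.
- by rewrite /= f4.2 // k1 -exprD addnn -mul2n -expnS.
- by rewrite /= f4.2 // k2 -exprD addnn -mul2n -expnS.
move=> i im /=; rewrite h4 //; apply: eq_bigr => j _.
by have := ltn_ord j => ji; rewrite k2 !k3 //; lia.
Unshelve.
rewrite /=; nia.
Qed.

Lemma ends_output s (m : nat) : nvar s 0 = m ->
  ends output s (m.+1 * 60) (fun s' =>
    forall j, (j <= m)%N -> cell s' 2 j = cell s 5 j * j`!%:R).
Proof.
move=> s0.
pose I k (s' : state R) := [/\ cell s' 3 2 = k%:R, cell s' 3 3 = k`!%:R &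
  forall j, (j < k)%N -> cell s' 2 j = cell s 5 j * j`!%:R].
apply: ends_mono (_ : ends _ _ (3 + (3 + _)) (I m.+1)) _ _; first last.
- by move=> s' _ [].
- shelve.
apply: (ends_seq (Q := fun s' => cell s' 3 2 = 0)).
  by apply: ends_straight => //=; rewrite rmorph0.
move=> s2 f2 h2.
apply: (ends_seq (Q := fun s' => cell s' 3 2 = 0 /\ cell s' 3 3 = 1)).
  by apply: ends_straight => //=; rewrite rmorph1.
move=> s3 f3 [h3 h3']; apply: (@ends_for _ _ _ _ m.+1 I) => //.
- by move=> s' f; rewrite /= f.1 // f3.1 // f2.1 // s0 addn1.
- by move=> s' f _; split; rewrite ?f.2 ?fact0.
move=> k s' km f s'3 [k1 k2 k3]; split.
- by rewrite /= rmorph1 k1 natr1.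
- by rewrite /= rmorph1 k1 k2 natr1 -natrM factS mulnC.
move=> j jk; rewrite /= s'3; case: eqP => [->|ne]; last by apply: k3; lia.
by rewrite k2 f.2 // f3.2 // f2.2.
Unshelve.
rewrite /=; lia.
Qed.

(** Table, first series and output cost O(2^l), since m + 1 <= 2 * 2^l, and each doubling round
    costs O((l + 1) 2^l). The factor [r.+1] covers the setup when no round is run. *)
Lemma ends_moment_program (rho : nat -> rat) (e z : rat) (N : nat)
    (alpha : 'I_N -> R) : exists K : nat, forall (m : nat) (eps : R) (l r : nat),
  (m + m + 2 <= 4 * 2 ^ l)%N ->
  (forall k, (k < l)%N -> (4 * 2 ^ k < m + m + 2)%N) ->
  ratr e ^+ (2 ^ r) <= eps ->
  (forall k, (k < r)%N -> eps < ratr e ^+ (2 ^ k)) ->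
  ends (moment_program rho N e z) (input alpha m eps)
    (K * (r.+1 * (l.+1 * 2 ^ l))) (fun s => forall j, (j <= m)%N ->
      cell s 2 j = j`!%:R * doubling (fun i =>
        \sum_(d < N) alpha d * ratr (rho d) ^+ i / i`!%:R) (ratr z) r j).
Proof.
pose c := (pcost (init_terms N) + pcost (coefficient_body rho N) + 50)%N.
exists (5000 + 10 * c)%N => m eps l r hl hk er ek.
set s := input alpha m eps; set q := (2 ^ l)%N.
have s0 : nvar s 0 = m by [].
have q0 : (0 < q)%N by rewrite expn_gt0.
have mq : (m + m + 2 <= q + q + q + q)%N by lia.
apply: ends_mono (_ : ends _ _ (_ + (_ + (_ + (_ + _)))) _) _ _; first last.
- by move=> s' _; exact: id.
- shelve.
apply: ends_seq (ends_choose_size s0 hl hk) _ => s1 f1 h1.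
apply: ends_seq (ends_fill_table h1) _ => s2 f2 h2.
apply: ends_seq (ends_coefficients (m := m) rho N _) _.
  by rewrite f2.1 // f1.1.
rewrite -/c => s3 f3 h3.
have nw : nwrites (coefficients rho N) = [:: 3; 3]%N.
  by rewrite /= nwrites_init_terms nwrites_next_terms.
have aw a : a != 3%N -> a != 5%N -> a != 9%N ->
    a \notin awrites (coefficients rho N).
  move=> a3 a5 a9; rewrite /= !(mem_cat, inE) !negb_or awrites_init_terms //.
  by rewrite awrites_next_terms // a3 a5.
have s3n x : x != 3%N -> nvar s3 x = nvar s2 x.
  by move=> x3; rewrite f3.1 // nw !inE negb_or x3.
have s30 : nvar s3 0 = m by rewrite s3n // f2.1 // f1.1.
have s3eps : cell s3 0 0 = eps.
  by rewrite f3.2 ?aw // f2.2 // f1.2.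
apply: ends_seq (ends_doubling_loop (m := m) (l := l) (r := r) (e := e) z
  _ _ _ _ _ _) _ => //.
- by rewrite s3n // f2.1.
- by rewrite f3.2 ?aw.
- by rewrite s3eps.
- by rewrite s3eps.
move=> s4 f4 h4.
apply: ends_mono (ends_output (m := m) _) (leqnn _) _.
  by rewrite f4.1.
move=> s5 f5 h5 j jm; rewrite h5 // h4 // mulrC; congr (_ * _).
have coefE i : (i <= m)%N -> cell s3 5 i =
    \sum_(d < N) alpha d * ratr (rho d) ^+ i / i`!%:R.
  move=> im; rewrite h3 //; apply: eq_bigr => d _; congr (_ * _ / _).
  by rewrite f2.2 // f1.2 // /s /= valK.
(* The initial coefficients are known only up to degree m, which suffices because degree j of a
   doubling depends on degrees at most j. *)
elim: r j jm {er ek h4 f4 h5 f5} => [|r IH] j jm /=; first exact: coefE.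
apply: eq_bigr => k _; have := ltn_ord k => kj.
by rewrite !IH //; lia.
Unshelve.
rewrite -/q.
set P := (r.+1 * (l.+1 * q))%N.
have P1 : (l.+1 * q <= P)%N by rewrite /P leq_pmull.
have P2 : (q <= l.+1 * q)%N by rewrite leq_pmull.
have P3 : (l.+1 <= l.+1 * q)%N by rewrite leq_pmulr.
have P4 : (r * (l.+1 * (q * 4000)) <= 4000 * P)%N.
  rewrite /P; nia.
have P5 : (m.+1 * c <= 10 * c * P)%N.
  rewrite mulnC [X in (_ <= X)%N]mulnC mulnCA mulnC; nia.
rewrite mulnDl; lia.
Qed.
End Specs.

(** * The weighted Cantor measure *)

Definition cantor_mfun (R : realType) (N n : nat) (x : measurableTypeR R) :
  measurableTypeR R := cantor_map N n (x : R).

Lemma continuous_cantor_map (R : realType) (N n : nat) :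
  continuous (cantor_map N n : R -> R).
Proof.
by move=> x; apply: cvgMl; apply: cvgD; [exact: cvg_id|exact: cvg_cst].
Qed.

Lemma measurable_cantor_mfun (R : realType) (N n : nat) :
  measurable_fun [set: measurableTypeR R] (@cantor_mfun R N n).
Proof. exact: continuous_measurable_fun (@continuous_cantor_map R N n). Qed.

HB.instance Definition _ (R : realType) (N n : nat) :=
  isMeasurableFun.Build _ _ (measurableTypeR R) (measurableTypeR R)
    (@cantor_mfun R N n) (@measurable_cantor_mfun R N n).

Lemma cantor_map_itv (R : realType) (N n : nat) (x : R) : (n < N)%N ->
  0 <= x <= 1 -> 0 <= cantor_map N n x <= 1.
Proof.
move=> nN /andP[x0 x1]; have N0 : 0 < N%:R :> R by rewrite ltr0n; case: N nN.
rewrite /cantor_map; apply/andP; split.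
  by rewrite divr_ge0 ?addr_ge0 // ltW.
rewrite ler_pdivrMr // mul1r.
by apply: (@le_trans _ _ (1 + n%:R)); rewrite ?lerD2r // nat1r ler_nat.
Qed.

Section CantorMeasure.
Variables (R : realType) (N : nat) (alpha : 'I_N -> R).
Variable mu : probability (measurableTypeR R) R.
Hypothesis halpha : in_simplex alpha.
Hypothesis hmu : is_weighted_cantor alpha mu.

Let D : set (measurableTypeR R) := `[0, 1].

Let mD : measurable D.
Proof. exact: measurable_itv. Qed.

Let muD : mu D = 1%E.
Proof.
have := probability_setC mu (measurableC mD); rewrite setCK => ->.
by rewrite hmu.1 sube0.
Qed.

(** [msum] is indexed by natural numbers, so the weights are extended by 0. *)
Let alpha_ge0 (n : nat) : 0 <= oapp alpha 0 (insub n : option 'I_N).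
Proof. by case: insubP => //= d _ _; exact: halpha.1. Qed.

Let weightE (n : 'I_N) : (NngNum (alpha_ge0 n))%:num = alpha n.
Proof.
have -> : (NngNum (alpha_ge0 n))%:num = oapp alpha 0 (insub (val n)) by [].
by rewrite valK.
Qed.

Let image_measure (n : nat) : {measure set (measurableTypeR R) -> \bar R} :=
  mscale (NngNum (alpha_ge0 n)) (distribution mu (@cantor_mfun R N n)).

(** Self-similarity equates [mu] with the weighted sum of its push-forwards. Cutting [f] off outside
    [0, 1] makes it nonnegative everywhere; the cut is harmless after composition because the maps
    preserve [0, 1] and the complement is null. *)
Lemma ge0_integral_cantor (f : R -> R) : continuous f ->
  (forall x, 0 <= x <= 1 -> 0 <= f x) ->
  (\int[mu]_(x in D) (f x)%:E =
   \sum_(n < N) (alpha n)%:E * \int[mu]_(x in D) (f (cantor_map N n x))%:E)%E.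
Proof.
move=> cf f0.
have mf : measurable_fun [set: measurableTypeR R] (f : measurableTypeR R -> R).
  exact: continuous_measurable_fun.
pose h : measurableTypeR R -> \bar R := (fun x => (f x)%:E) \_ D.
have mh : measurable_fun [set: measurableTypeR R] h.
  apply/(measurable_restrictT _ mD)/measurable_funTS.
  exact/measurable_EFinP.
have h0 x : (0 <= h x)%E.
  rewrite /h patchE; case: ifPn => // /set_mem; rewrite /D /= in_itv /= => xD.
  by rewrite lee_fin f0.
rewrite integral_mkcond -/h.
rewrite (@eq_measure_integral _ _ _ _ (msum image_measure N)); last first.
  move=> A mA _; apply: (etrans (hmu.2 A mA)).
  rewrite /msum; apply: eq_bigr => n _.
  by rewrite /image_measure /= /mscale weightE; congr (_ * _)%E.
rewrite ge0_integral_measure_sum //; apply: eq_bigr => n _.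
rewrite ge0_integral_mscale // weightE; congr (_ * _)%E.
rewrite ge0_integral_pushforward //.
rewrite preimage_setT (@ge0_negligible_integral _ _ _ mu _ (~` D)) //=.
- rewrite setTD setCK; apply: eq_integral => x /set_mem xD.
  rewrite /h /= patchE mem_set // /D /= in_itv /=; apply: cantor_map_itv => //.
- exact: measurableC.
- exact: measurableT_comp mh (measurable_cantor_mfun N n).
- exact: hmu.1.
Qed.

Lemma continuous_bounded01 (f : R -> R) : continuous f ->
  exists c : R, forall x, 0 <= x <= 1 -> `|f x| <= c.
Proof.
move=> cf.
have cwf : {within `[0, 1], continuous (fun x => `|f x|)}.
  apply: continuous_subspaceT => x.
  by apply: continuous_comp (cf x) _; exact: norm_continuous.
have [c _ hc] := EVT_max ler01 cwf.
by exists `|f c| => x hx; apply: hc; rewrite in_itv.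
Qed.

Lemma integrable_continuous (f : R -> R) : continuous f ->
  mu.-integrable D (EFin \o f).
Proof.
move=> cf; apply: measurable_bounded_integrable => //.
- by rewrite [X in (X < _)%E]muD ltry.
- by apply: measurable_funTS; exact: continuous_measurable_fun.
have [c hc] := continuous_bounded01 cf.
exists c; split; first exact: num_real.
move=> y cy x xD; apply: le_trans (ltW cy); apply: hc.
by move: xD; rewrite /D /= in_itv.
Qed.

Local Notation M f := (Rintegral mu D f).

Lemma EFin_Rintegral_continuous (f : R -> R) : continuous f ->
  (\int[mu]_(x in D) (f x)%:E)%E = (M f)%:E.
Proof.
by move=> cf; rewrite /Rintegral fineK //; apply: integrable_fin_num => //;
  exact: integrable_continuous.
Qed.

Lemma Rintegral_cst01 (c : R) : M (fun=> c) = c.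
Proof. by rewrite Rintegral_cst // [X in fine X]muD mulr1. Qed.

Lemma continuous_comp_cantor (f : R -> R) (n : nat) : continuous f ->
  continuous (fun x => f (cantor_map N n x)).
Proof.
move=> cf x; apply: continuous_comp (cf _).
exact: continuous_cantor_map.
Qed.

(** Adding a bound c of |f| reduces to the nonnegative case; c cancels because the weights sum to
    1. *)
Lemma Rintegral_cantor (f : R -> R) : continuous f ->
  M f = \sum_(n < N) alpha n * M (fun x => f (cantor_map N n x)).
Proof.
move=> cf; have [c hc] := continuous_bounded01 cf.
have cc : continuous (fun _ : R => c) by move=> x; exact: cvg_cst.
have cfc : continuous (fun x => f x + c) by move=> x; exact: cvgD (cf x) (cc x).
have shift (g : R -> R) : continuous g -> M (fun x => g x + c) = M g + c.
  move=> cg; rewrite RintegralD ?Rintegral_cst01 //;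
  exact: integrable_continuous.
have H : (M f + c)%:E =
    (\sum_(n < N) alpha n * (M (fun x => f (cantor_map N n x)) + c))%:E.
  rewrite -shift // -EFin_Rintegral_continuous // ge0_integral_cantor //.
    rewrite -sumEFin; apply: eq_bigr => n _; rewrite EFinM -shift.
      by rewrite -EFin_Rintegral_continuous //; exact: (continuous_comp_cantor cfc).
    exact: (continuous_comp_cantor cf).
  by move=> x hx; rewrite -lerBlDr sub0r lerNl (le_trans (ler_norm _)) // normrN hc.
have {H} := EFin_inj H; under eq_bigr do rewrite mulrDr.
by rewrite big_split /= -mulr_suml halpha.2 mul1r => /addIr.
Qed.

Lemma Rintegral_lincomb (F : 'I_N -> R -> R) (s : seq 'I_N) :
  (forall n, continuous (F n)) ->
  continuous (fun x => \sum_(n <- s) alpha n * F n x) /\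
  M (fun x => \sum_(n <- s) alpha n * F n x) = \sum_(n <- s) alpha n * M (F n).
Proof.
move=> cF.
elim: s => [|n s [cs Ms]].
  rewrite big_nil; split.
    rewrite (_ : (fun x => _) = fun=> 0); last by apply: funext => x; rewrite big_nil.
    by move=> x; exact: cvg_cst.
  rewrite (_ : (fun x => _) = fun=> 0) ?Rintegral_cst01 //.
  by apply: funext => x; rewrite big_nil.
have -> : (fun x => \sum_(i <- n :: s) alpha i * F i x) =
    (fun x => alpha n * F n x + \sum_(i <- s) alpha i * F i x).
  by apply: funext => x; rewrite big_cons.
have cn : continuous (fun x => alpha n * F n x).
  by move=> x; apply: cvgM; [exact: cvg_cst|exact: cF].
split; first by move=> x; exact: cvgD (cn x) (cs x).
rewrite RintegralD //; [|exact: integrable_continuous..].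
rewrite RintegralZl //; last exact: integrable_continuous.
by rewrite big_cons Ms.
Qed.

(** The Markov operator of the iterated function system; [mu] is invariant under its dual. *)
Definition transfer (f : R -> R) (x : R) : R :=
  \sum_(n < N) alpha n * f (cantor_map N n x).

Lemma continuous_transfer (f : R -> R) : continuous f -> continuous (transfer f).
Proof.
move=> cf; apply: (Rintegral_lincomb _ _).1 => n.
exact: continuous_comp_cantor.
Qed.

Lemma Rintegral_transfer (f : R -> R) : continuous f -> M f = M (transfer f).
Proof.
move=> cf; rewrite (Rintegral_lincomb _ _).2.
  exact: Rintegral_cantor.
by move=> n; exact: continuous_comp_cantor.
Qed.

Lemma Rintegral_iter_transfer (K : nat) (f : R -> R) : continuous f ->
  continuous (iter K transfer f) /\ M f = M (iter K transfer f).
Proof.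
move=> cf; elim: K => [//|K [cK ->]]; split; first exact: continuous_transfer.
exact: Rintegral_transfer.
Qed.

Lemma Rintegral_near_cst (f : R -> R) (c e : R) : continuous f ->
  (forall x, 0 <= x <= 1 -> `|f x - c| <= e) -> `|M f - c| <= e.
Proof.
move=> cf hf.
have ic (a : R) : mu.-integrable D (EFin \o (fun=> a)).
  by apply: integrable_continuous => x; exact: cvg_cst.
have hD x : D x -> 0 <= x <= 1 by rewrite /D /= in_itv.
rewrite ler_distl -(Rintegral_cst01 (c - e)) -(Rintegral_cst01 (c + e)).
have If : mu.-integrable D (EFin \o f) by exact: integrable_continuous.
apply/andP; split.
  by apply: le_Rintegral => // x /hD /hf; rewrite ler_distl => /andP[].
by apply: le_Rintegral => // x /hD /hf; rewrite ler_distl => /andP[].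
Qed.

End CantorMeasure.

(** * Contraction and doubling *)

Section Transfer.
Variables (R : realType) (N : nat) (alpha : 'I_N -> R).
Hypothesis hN : (0 < N)%N.
Hypothesis halpha : in_simplex alpha.
Local Notation T := (transfer alpha).

Definition nondecreasing01 (f : R -> R) : Prop :=
  forall x y, 0 <= x -> x <= y -> y <= 1 -> f x <= f y.

Lemma transfer_nondecreasing (f : R -> R) :
  nondecreasing01 f -> nondecreasing01 (T f).
Proof.
move=> hf x y x0 xy y1; apply: ler_sum => n _.
have /andP[a0 _] : 0 <= cantor_map N n x <= 1.
  by apply: cantor_map_itv => //; rewrite x0 (le_trans xy).
have /andP[_ b1] : 0 <= cantor_map N n y <= 1.
  by apply: cantor_map_itv => //; rewrite (le_trans x0).
apply: ler_wpM2l; first exact: halpha.1.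
apply: hf => //; rewrite /cantor_map ler_wpM2r ?lerD2r ?invr_ge0 //.
Qed.

(* The images of [0, 1] under the N maps tile [0, 1], so the increments of f
   over them add up to its increment over [0, 1]. *)
Lemma transfer_oscillation (a : R) (f : R -> R) :
  (forall n, alpha n <= a) -> nondecreasing01 f ->
  T f 1 - T f 0 <= a * (f 1 - f 0).
Proof.
move=> ha hf; pose F k := f (k%:R / N%:R).
have N0 : N%:R != 0 :> R by rewrite pnatr_eq0 -lt0n.
have -> : f 1 - f 0 = \sum_(n < N) (F n.+1 - F n).
  rewrite -(big_mkord xpredT (fun n => F n.+1 - F n)) telescope_sumr // /F.
  by rewrite divff // mul0r.
rewrite /transfer -sumrB mulr_sumr; apply: ler_sum => n _.
rewrite /cantor_map nat1r add0r -mulrBr ler_wpM2r //.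
rewrite subr_ge0; apply: hf.
- by rewrite divr_ge0.
- by rewrite ler_wpM2r ?invr_ge0 // ler_nat.
- by rewrite ler_pdivrMr ?mul1r ?ler_nat // ltr0n.
Qed.

(** Iterates of a nondecreasing function stay nondecreasing, so their oscillation is the increment
    from 0 to 1, which each step multiplies by at most a. *)
Lemma iter_transfer_oscillation (a : R) (f : R -> R) (K : nat) (x y : R) :
  (forall n, alpha n <= a) -> nondecreasing01 f ->
  0 <= x <= 1 -> 0 <= y <= 1 ->
  `|iter K T f x - iter K T f y| <= a ^+ K * (f 1 - f 0).
Proof.
move=> ha hf /andP[x0 x1] /andP[y0 y1].
have a0 : 0 <= a by exact: le_trans (halpha.1 (Ordinal hN)) (ha _).
have [mono osc] : nondecreasing01 (iter K T f) /\
    iter K T f 1 - iter K T f 0 <= a ^+ K * (f 1 - f 0).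
  elim: K => [|K [IH1 IH2]]; first by rewrite expr0 mul1r.
  split; first exact: transfer_nondecreasing.
  apply: le_trans (transfer_oscillation ha IH1) _.
  by rewrite exprS -mulrA ler_wpM2l.
apply: le_trans osc.
have ge0 z : 0 <= z -> z <= 1 -> iter K T f 0 <= iter K T f z by move=> *; exact: mono.
have le1 z : 0 <= z -> z <= 1 -> iter K T f z <= iter K T f 1 by move=> *; exact: mono.
have := ge0 x x0 x1; have := ge0 y y0 y1; have := le1 x x0 x1; have := le1 y y0 y1.
by move=> *; rewrite ler_norml; apply/andP; split; lra.
Qed.

Lemma iter_transfer_lincomb (f g : R -> R) (b : R) (K : nat) (x : R) :
  iter K T (fun y => f y + b * g y) x = iter K T f x + b * iter K T g x.
Proof.
elim: K x => //= K IH x; rewrite /transfer mulr_sumr -big_split /=.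
by apply: eq_bigr => n _; rewrite IH mulrDr mulrCA.
Qed.

(* A power of x - s is a combination of two monotone functions, whose
   oscillations add up to at most 1. *)
Lemma iter_transfer_power (a s : R) (j K : nat) (x y : R) :
  (forall n, alpha n <= a) -> 0 <= s <= 1 -> (0 < j)%N ->
  0 <= x <= 1 -> 0 <= y <= 1 ->
  `|iter K T (fun z => (z - s) ^+ j) x - iter K T (fun z => (z - s) ^+ j) y|
  <= a ^+ K.
Proof.
move=> ha /andP[s0 s1] j0 hx hy.
(* Powers of the positive and negative parts of z - s; the minus sign in [h] makes it nondecreasing.
   Their increments are (1 - s)^j <= 1 - s and s^j <= s, where j > 0 matters. *)
pose g z : R := Num.max (z - s) 0 ^+ j.
pose h z : R := - Num.max (s - z) 0 ^+ j.
have a0 : 0 <= a by exact: le_trans (halpha.1 (Ordinal hN)) (ha _).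
have fE : (fun z => (z - s) ^+ j) = (fun z => g z + - (-1) ^+ j * h z).
  apply: funext => z; rewrite /g /h mulrNN.
  have [zs|zs] := leP z s.
    rewrite max_r ?subr_le0 // max_l ?subr_ge0 // expr0n gtn_eqF // add0r.
    by rewrite -exprMn mulN1r opprB.
  rewrite max_l ?subr_ge0 ?ltW // max_r ?subr_le0 ?ltW //.
  by rewrite expr0n gtn_eqF // mulr0 addr0.
have mg : nondecreasing01 g.
  move=> u v _ uv _; rewrite /g; apply: lerXn2r; [by rewrite nnegrE le_max lexx orbT..|].
  by rewrite ge_max !le_max lerD2r uv lexx orbT.
have mh : nondecreasing01 h.
  move=> u v _ uv _; rewrite /h lerN2; apply: lerXn2r; [by rewrite nnegrE le_max lexx orbT..|].
  by rewrite ge_max !le_max lerD2l lerN2 uv lexx orbT.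
have pow_le (t : R) : 0 <= t -> t <= 1 -> t ^+ j <= t.
  by move=> t0 t1; case: j j0 {g h fE mg mh} => // j _; rewrite exprS ler_piMr // exprn_ile1.
have og : g 1 - g 0 <= 1 - s.
  rewrite /g max_l ?subr_ge0 // max_r ?sub0r ?oppr_le0 // expr0n gtn_eqF // subr0.
  by apply: pow_le; rewrite ?subr_ge0 // gerBl.
have oh : h 1 - h 0 <= s.
  rewrite /h subr0 max_r ?subr_le0 // max_l // expr0n gtn_eqF // oppr0 sub0r opprK.
  exact: pow_le.
rewrite fE !iter_transfer_lincomb.
have -> (u v u' v' b : R) : u + b * v - (u' + b * v') = (u - u') + b * (v - v').
  by ring.
apply: le_trans (ler_normD _ _) _.
rewrite normrM normrN normrX normrN1 expr1n mul1r.
apply: le_trans (lerD (iter_transfer_oscillation K ha mg hx hy)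
                      (iter_transfer_oscillation K ha mh hx hy)) _.
rewrite -mulrDr -[leRHS]mulr1 ler_wpM2l ?exprn_ge0 //; lra.
Qed.

(** The pairs run over the words of length K: the product of the weights, and the displacement of s
    under the composed map. All composed maps share the slope N^-K. *)
Lemma iter_transfer_expand (s : R) (K : nat) : exists r : seq (R * R),
  forall f y, iter K T f (s + y) =
    \sum_(p <- r) p.1 * f (s + (N%:R^-1) ^+ K * y + p.2).
Proof.
have N0 : N%:R != 0 :> R by rewrite pnatr_eq0 -lt0n.
elim: K => [|K [r hr]].
  exists [:: (1, 0)] => f y.
  by rewrite big_seq1 /= mul1r expr0 mul1r addr0.
exists [seq (alpha n * p.1,
    (N%:R^-1) ^+ K.+1 * (n%:R - s * (N%:R - 1)) + p.2) |
  n <- enum 'I_N, p <- r] => f y.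
rewrite big_allpairs_dep /= /transfer big_enum /=; apply: eq_bigr => n _.
have -> : cantor_map N n (s + y) =
    s + (y + (n%:R - s * (N%:R - 1))) / N%:R :> R.
  by rewrite /cantor_map; field.
rewrite hr mulr_sumr; apply: eq_bigr => p _; rewrite mulrA; congr (_ * f _).
by rewrite exprSr; ring.
Qed.

(** Expand each power of N^-K y plus a displacement; the weighted sums of powers of displacements
    are the iterates at y = 0. *)
Lemma iter_transfer_binomial (s y : R) (j K : nat) :
  iter K T (fun z => (z - s) ^+ j) (s + y) =
  \sum_(i < j.+1) 'C(j, i)%:R * iter K T (fun z => (z - s) ^+ i) s
    * ((N%:R^-1) ^+ K * y) ^+ (j - i).
Proof.
have [r hr] := iter_transfer_expand s K.
rewrite hr.
under [RHS]eq_bigr => i _ do rewrite -[s in X in _ * X * _]addr0 hr mulr_sumr mulr_suml.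
rewrite exchange_big /=; apply: eq_bigr => p _.
have -> : s + (N%:R^-1) ^+ K * y + p.2 - s = (N%:R^-1) ^+ K * y + p.2 by ring.
rewrite exprDn mulr_sumr; apply: eq_bigr => i _.
have -> : s + (N%:R^-1) ^+ K * 0 + p.2 - (s + 0) = p.2 by ring.
by rewrite -mulr_natl; ring.
Qed.

(** The inner K steps yield a polynomial in x - s, to which the outer K steps apply term by term.
    Division by factorials turns the binomial convolution into a Cauchy product. *)
Lemma iter_transfer_double (s : R) (j K : nat) (z := (N%:R^-1 : R) ^+ K)
    (g := fun i => iter K T (fun x => (x - s) ^+ i) s / i`!%:R) :
  iter (K + K) T (fun x => (x - s) ^+ j) s / j`!%:R =
  \sum_(i < j.+1) g i * (g (j - i)%N * z ^+ (j - i)).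
Proof.
rewrite iterD.
have -> : iter K T (fun x => (x - s) ^+ j) = fun x =>
   \sum_(i < j.+1) ('C(j, i)%:R * iter K T (fun z => (z - s) ^+ i) s * z ^+ (j - i))
     * (x - s) ^+ (j - i).
  apply: funext => x; rewrite -{1}(subrKC s x) iter_transfer_binomial.
  by apply: eq_bigr => i _; rewrite exprMn mulrA.
have lin (m : nat) (c : nat -> R) (F : nat -> R -> R) :
    iter K T (fun x => \sum_(i < m) c i * F i x) s =
    \sum_(i < m) c i * iter K T (F i) s.
  elim: m => [|m IH].
    under eq_fun do rewrite big_ord0.
    (* Linearity applied to 0 = 0 - 0 shows that the iterates of the zero function vanish. *)
    rewrite big_ord0; have := iter_transfer_lincomb (fun=> 0) (fun=> 0) (-1) K s.
    rewrite (_ : (fun=> _) = fun=> 0) => [->|]; first by rewrite mulN1r subrr.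
    by apply: funext => x; rewrite mulr0 addr0.
  under eq_fun do rewrite big_ord_recr /=.
  by rewrite iter_transfer_lincomb IH big_ord_recr.
rewrite (lin _ (fun i => 'C(j, i)%:R * iter K T (fun z => (z - s) ^+ i) s * z ^+ (j - i))
  (fun i x => (x - s) ^+ (j - i))).
rewrite mulr_suml; apply: eq_bigr => i _.
have ij : (i <= j)%N by rewrite -ltnS.
have fact_unit k : k`!%:R != 0 :> R by rewrite pnatr_eq0 -lt0n fact_gt0.
rewrite /g -(bin_fact ij) !natrM.
have C0 : 'C(j, i)%:R != 0 :> R by rewrite pnatr_eq0 -lt0n bin_gt0.
have := fact_unit i; have := fact_unit (j - i)%N => h1 h2.
by field; rewrite h1 h2 C0.
Qed.

(** The start is a single step at s, where the n-th map displaces s by (n - s (N - 1)) / N. *)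
Lemma iter_transfer_doubling (s : R) (r j : nat) :
  iter (2 ^ r) T (fun x => (x - s) ^+ j) s / j`!%:R =
  doubling (fun i => \sum_(n < N)
    alpha n * ((n%:R - s * (N%:R - 1)) / N%:R) ^+ i / i`!%:R) N%:R^-1 r j.
Proof.
have N0 : N%:R != 0 :> R by rewrite pnatr_eq0 -lt0n.
elim: r j => [|r IH] j /=.
  rewrite /transfer mulr_suml; apply: eq_bigr => n _.
  by congr (_ * _ ^+ _ / _); rewrite /cantor_map; field.
rewrite expnS mul2n -addnn iter_transfer_double; apply: eq_bigr => i _.
by rewrite !IH.
Qed.
End Transfer.

(** * Time bound and moments *)

Lemma expr_eventually_le (R : realType) (x eps : R) : 0 <= x < 1 -> 0 < eps ->
  exists n, x ^+ n <= eps.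
Proof.
move=> /andP[x0 x1] e0.
have /cvgrPdist_le/(_ _ e0)[n _ hn] : (fun n => x ^+ n) @ \oo --> (0 : R).
  by apply: cvg_expr; rewrite ger0_norm.
exists n; have := hn n (leqnn n).
by rewrite /= sub0r normrN ger0_norm // exprn_ge0.
Qed.

Section Time.
Variable R : realType.

(** These l and r are the round counts of [choose_size] and [doubling_loop]. *)
Definition minimal_exponents (e : R) (m : nat) (eps : R) (l r : nat) : Prop :=
  [/\ (m + m + 2 <= 4 * 2 ^ l)%N,
      (forall k, (k < l)%N -> (4 * 2 ^ k < m + m + 2)%N),
      e ^+ (2 ^ r) <= eps &
      forall k, (k < r)%N -> eps < e ^+ (2 ^ k)].

Lemma exists_minimal_exponents (e : R) (m : nat) (eps : R) :
  0 <= e < 1 -> 0 < eps -> exists l r, minimal_exponents e m eps l r.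
Proof.
move=> he eps0.
have exl : exists l, (m + m + 2 <= 4 * 2 ^ l)%N.
  by exists m; have := @ltn_expl 2 m isT; lia.
have exr : exists r, e ^+ (2 ^ r) <= eps.
  have [n hn] := expr_eventually_le he eps0; exists n.
  apply: le_trans hn; case/andP: he => e0 e1.
  by apply: ler_wiXn2l => //; [exact: ltW|exact/ltnW/ltn_expl].
exists (ex_minn exl), (ex_minn exr); case: ex_minnP => l hl minl.
case: ex_minnP => r hr minr; split => //.
  by move=> k; rewrite ltnNge => h; rewrite ltnNge; apply: contra h => /minl.
by move=> k; rewrite ltnNge => h; rewrite ltNge; apply: contra h => /minr.
Qed.

(** Failure at l - 1 gives 2^l <= m, so l <= log_2 m, and 1 <= log_2 m absorbs the successor. *)
Lemma minimal_size (e : R) (m l r : nat) (eps : R) : (2 <= m)%N ->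
  minimal_exponents e m eps l r ->
  (2 ^ l <= m)%N /\ l.+1%:R <= 2 / ln 2 * ln (m%:R : R).
Proof.
move=> m2 [_ hl _ _].
have lm : (2 ^ l <= m)%N.
  case: l hl => [|l] hl; first by rewrite expn0; lia.
  by have := hl l (ltnSn l); rewrite expnS; lia.
split=> //.
have ln2 : 0 < ln (2 : R) by rewrite ln_gt0 // ltr1n.
have h1 : l%:R * ln 2 <= ln (m%:R : R).
  rewrite mulrC mulr_natr -lnXn ?ltr0n // ler_ln ?posrE ?exprn_gt0 ?ltr0n //; last lia.
  by rewrite -natrX ler_nat.
have h2 : ln 2 <= ln (m%:R : R) by rewrite ler_ln ?posrE ?ltr0n ?ler_nat //; lia.
rewrite -natr1 mulrAC ler_pdivlMr // mulrDl mul1r; lra.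
Qed.

(** For r > 0, failure at r - 1 gives eps < e^(2^(r - 1)). Two logarithms turn this into (r - 1) ln
    2 + ln (- ln e) < ln (ln (1/eps)), whose right side is at least 1 and absorbs the constants. *)
Lemma minimal_rounds (e : R) : 0 <= e < 1 -> exists A : R,
  forall m eps l r, 0 < eps -> 1 <= ln (ln eps^-1) ->
    minimal_exponents e m eps l r -> r.+1%:R <= A * ln (ln eps^-1).
Proof.
move=> /andP[e0 e1].
have ln2 : 0 < ln (2 : R) by rewrite ln_gt0 // ltr1n.
set c := ln (- ln e); exists ((1 + `|c|) / ln 2 + 2) => m eps l r eps0 LL [_ _ _ hr].
set L := ln (ln eps^-1) in LL *.
have A0 : 0 <= (1 + `|c|) / ln 2 by rewrite divr_ge0 ?ltW // addr_ge0.
case: r hr => [|r] hr; first by nra.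
have := hr r (ltnSn r).
(* For e = 0 a positive number of rounds would force eps < 0. *)
have [e00|e00] := eqVneq e 0.
  by rewrite e00 expr0n expn_eq0 /= ltNge ltW.
have ep : 0 < e by rewrite lt0r e00.
have lne : 0 < - ln e by rewrite oppr_gt0 ln_lt0 // ep.
move=> h.
have h1 : (2 ^ r)%:R * (- ln e) < ln eps^-1.
  rewrite lnV ?posrE // mulrN ltrN2 mulrC mulr_natr -lnXn //.
  by rewrite ltr_ln ?posrE ?exprn_gt0.
have h2 : r%:R * ln 2 + c < L.
  have p0 : 0 < (2 ^ r)%:R :> R by rewrite ltr0n expn_gt0.
  have := h1; rewrite -ltr_ln ?posrE ?mulr_gt0 //; last first.
    by apply: lt_trans h1; rewrite mulr_gt0.
  by rewrite lnM ?posrE // natrX lnXn // -[X in X + _]mulr_natl.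
have h3 : - `|c| <= c by rewrite lerNl ler_normr lexx orbT.
have h4 : r%:R <= (1 + `|c|) / ln 2 * L.
  rewrite mulrAC ler_pdivlMr //.
  have : 0 <= `|c| by [].
  nra.
have -> : r.+2%:R = r%:R + 2 :> R by rewrite -addn2 natrD.
rewrite mulrDl; move: h4; move: (_ * L) => B h4; lra.
Qed.

Lemma moment_program_estimates (N : nat) (alpha : 'I_N -> R)
    (rho : nat -> rat) (e z : rat) (c : nat -> R) : 0 <= (ratr e : R) < 1 ->
  (forall m eps l r j, 0 < eps -> minimal_exponents (ratr e) m eps l r ->
    (0 < j)%N ->
    `|j`!%:R * doubling (fun i =>
        \sum_(d < N) alpha d * ratr (rho d) ^+ i / i`!%:R) (ratr z) r j - c j|
    <= eps) ->
  exists (p : prog) (T : nat -> R -> nat),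
    estimates_in_time alpha p c T /\ time_bound T.
Proof.
move=> he hc; exists (moment_program rho N e z).
have [K hK] := ends_moment_program rho e z alpha.
(* Guarding by 0 < eps inside the existential lets [choice] produce a total time function. *)
have H (x : nat * R) : exists t, 0 < x.2 ->
    (exists2 s : state R, run (moment_program rho N e z) (input alpha x.1 x.2) t s &
      forall j : nat, (1 <= j <= x.1)%N -> `|cell s 2 j - c j| <= x.2) /\
    exists l r, minimal_exponents (ratr e) x.1 x.2 l r /\
      (t <= K * (r.+1 * (l.+1 * 2 ^ l)))%N.
  have [eps0|] := boolP (0 < x.2); last by exists 0%N.
  have [l [r lr]] := exists_minimal_exponents x.1 he eps0.
  have [h1 h2 h3 h4] := lr.
  have [t [s [hrun ht hs]]] := hK _ _ _ _ h1 h2 h3 h4.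
  exists t => _; split; last by exists l, r.
  by exists s => // j /andP[j1 jm]; rewrite hs //; exact: hc eps0 lr j1.
have [T hT] := choice H.
exists (fun m eps => T (m, eps)); split.
  by move=> m eps eps0; exact: (hT (m, eps) eps0).1.
have [A hA] := minimal_rounds he.
(* Below this threshold ln (ln (1/eps)) >= 1. *)
exists (K%:R * A * (2 / ln 2)), 2%N, (expR (- expR 1)).
split; first exact: expR_gt0.
move=> m eps m2 eps0 epsle.
have LL : 1 <= ln (ln eps^-1).
  have h1 : expR 1 <= ln eps^-1.
    by rewrite lnV ?posrE // lerNr -[leRHS]expRK ler_ln ?posrE ?expR_gt0.
  by rewrite -[leLHS]expRK ler_ln ?posrE ?expR_gt0 // (lt_le_trans _ h1) ?expR_gt0.
have [_ [l [r [lr tle]]]] := hT (m, eps) eps0.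
have [lm hl] := minimal_size m2 lr.
have hr := hA _ _ _ _ eps0 LL lr.
apply: (@le_trans _ _ (K * (r.+1 * (l.+1 * 2 ^ l)))%:R); first by rewrite ler_nat.
rewrite !natrM -!mulrA ler_wpM2l //.
rewrite [leRHS](_ : _ = (A * ln (ln eps^-1)) * (2 / ln 2 * ln m%:R * m%:R)); last by ring.
apply: ler_pM => //.
apply: ler_pM => //; by rewrite ler_nat.
Qed.
End Time.

(** * Approximation of the moments *)

Section Moments.
Variables (R : realType) (N : nat) (alpha : 'I_N -> R).
Variable mu : probability (measurableTypeR R) R.
Hypothesis hN : (2 <= N)%N.
Hypothesis halpha : in_simplex alpha.
Hypothesis hmu : is_weighted_cantor alpha mu.

(** A common form of both families: s = 0 gives I_j and s = 1/2 gives J_j. *)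
Definition centered_moment (s : R) (j : nat) : R :=
  \int[mu]_(x in `[0, 1]) (x - s) ^+ j.

Lemma continuous_centered_power (s : R) (j : nat) :
  continuous (fun x : R => (x - s) ^+ j).
Proof.
move=> x; apply: (@continuous_comp _ _ _ (fun x : R => x - s) (fun x => x ^+ j)).
  by apply: cvgB; [exact: cvg_id|exact: cvg_cst].
exact: exprn_continuous.
Qed.

(** The moment is also the mean of the K-th iterate, which varies by at most a^K on [0, 1]. *)
Lemma centered_moment_approx (a s : R) (j K : nat) :
  (forall n, alpha n <= a) -> 0 <= s <= 1 -> (0 < j)%N ->
  `|iter K (transfer alpha) (fun x => (x - s) ^+ j) s - centered_moment s j|
  <= a ^+ K.
Proof.
move=> ha hs j0; rewrite distrC /centered_moment.
have [cK ->] := Rintegral_iter_transfer halpha hmu K (@continuous_centered_power s j).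
apply: (Rintegral_near_cst hmu cK) => x hx.
by apply: iter_transfer_power => //; exact: leq_trans hN.
Qed.

Lemma distX_le (u v : R) (j : nat) : `|u| <= 1 -> `|v| <= 1 ->
  `|u ^+ j - v ^+ j| <= j%:R * `|u - v|.
Proof.
move=> hu hv; elim: j => [|j IH]; first by rewrite !expr0 subrr normr0 mul0r.
have -> : u ^+ j.+1 - v ^+ j.+1 = u * (u ^+ j - v ^+ j) + v ^+ j * (u - v).
  by rewrite !exprS; ring.
apply: le_trans (ler_normD _ _) _; rewrite -natr1 mulrDl !normrM normrX.
apply: lerD; last by rewrite ler_wpM2r // exprn_ile1.
by apply: le_trans IH; rewrite ler_piMl.
Qed.

(* With a single positive weight mu is the point mass at the fixed point of
   the corresponding map. *)
Lemma centered_moment_point_mass (n : 'I_N) (s : R) (j : nat) :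
  1 <= alpha n -> 0 <= s <= 1 ->
  centered_moment s j = (n%:R / (N%:R - 1) - s) ^+ j.
Proof.
move=> an hs; set p := n%:R / (N%:R - 1).
have N1 : 0 < N%:R - 1 :> R by rewrite subr_gt0 ltr1n.
have N0 : 0 < N%:R :> R by rewrite ltr0n; exact: leq_trans hN.
have a1 k : alpha k = (k == n)%:R.
  have [a0 a_sum] := halpha.
  move: a_sum; rewrite (bigD1 n) //= => a_sum.
  have r0 : 0 <= \sum_(i < N | i != n) alpha i by apply: sumr_ge0.
  have aS : alpha n = 1 /\ \sum_(i < N | i != n) alpha i = 0.
    by move: r0 a_sum; move: (\sum_(_ < _ | _) _) => S S0 aS; split; lra.
  have [->|kn] := eqVneq k n; first exact: aS.1.
  have /eqP := aS.2; rewrite psumr_eq0 // => /allP/(_ k (mem_index_enum k)).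
  by rewrite kn => /eqP.
have tE (f : R -> R) x : transfer alpha f x = f (cantor_map N n x).
  rewrite /transfer (bigD1 n) //= a1 eqxx mul1r big1 ?addr0 // => k kn.
  by rewrite a1 (negPf kn) mul0r.
have iE (f : R -> R) K x :
    iter K (transfer alpha) f x = f (p + (N%:R^-1) ^+ K * (x - p)).
  elim: K x => [|K IH] x /=; first by rewrite expr0 mul1r addrC subrK.
  rewrite tE IH exprSr; congr f.
  by rewrite /cantor_map /p; field; rewrite !gt_eqF.
have p01 : 0 <= p <= 1.
  apply/andP; split; first by rewrite divr_ge0 // ltW.
  by rewrite /p ler_pdivrMr // mul1r lerBrDr natr1 ler_nat ltn_ord.
(* K steps bring all of [0, 1] within N^-K of the fixed point p, and the power is j-Lipschitz
   there. *)
have bound K : `|centered_moment s j - (p - s) ^+ j| <= j%:R * (N%:R^-1) ^+ K.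
  rewrite /centered_moment.
  have [cK ->] := Rintegral_iter_transfer halpha hmu K (@continuous_centered_power s j).
  apply: (Rintegral_near_cst hmu cK) => x hx; rewrite iE.
  set t := (N%:R^-1) ^+ K.
  have /andP[t0 t1] : 0 <= t <= 1.
    have z0 : 0 <= N%:R^-1 :> R by rewrite invr_ge0.
    apply/andP; split; first exact: exprn_ge0.
    by rewrite exprn_ile1 // invf_le1 // ler1n; exact: leq_trans hN.
  case/andP: hx => x0 x1; case/andP: p01 => p0 p1; case/andP: hs => s0 s1.
  have h1 : 0 <= t * x by rewrite mulr_ge0.
  have h2 : t * x <= t by rewrite ler_piMr.
  have h3 : 0 <= (1 - t) * p by rewrite mulr_ge0 ?subr_ge0.
  have h4 : (1 - t) * p <= 1 - t by rewrite ler_piMr ?subr_ge0.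
  apply: le_trans (distX_le _ _ _) _.
  - by rewrite ler_norml; apply/andP; split; lra.
  - by rewrite ler_norml; apply/andP; split; lra.
  rewrite ler_wpM2l // (_ : _ - _ = t * (x - p)); last by ring.
  by rewrite normrM ger0_norm // ler_piMr // ler_norml; apply/andP; split; lra.
apply/eqP; rewrite -subr_eq0 -normr_eq0; apply/negPn/negP => nz.
set d := `|_| in nz bound.
have d0 : 0 < d by rewrite lt0r nz normr_ge0.
have j10 : 0 < j%:R + 1 :> R by rewrite ltr_wpDl.
(* Dividing by j + 1 makes the contradiction strict and includes j = 0. *)
have [||K hK] := @expr_eventually_le R N%:R^-1 (d / (j%:R + 1)).
- by rewrite invr_ge0 ltW //= invf_lt1 // ltr1n.
- by rewrite divr_gt0.
have := bound K; apply/negP; rewrite -ltNge.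
apply: (@le_lt_trans _ _ (j%:R * (d / (j%:R + 1)))); first by rewrite ler_wpM2l.
rewrite mulrA ltr_pdivrMr // mulrC ltr_pM2l //; lra.
Qed.

Lemma centered_moment_estimates (sigma : rat) : 0 <= (ratr sigma : R) <= 1 ->
  exists (p : prog) (T : nat -> R -> nat),
    estimates_in_time alpha p (centered_moment (ratr sigma)) T /\ time_bound T.
Proof.
move=> hs; set s : R := ratr sigma.
have N0 : (0 < N)%N by exact: leq_trans hN.
have [[n an]|nodeg] := pselect (exists n, 1 <= alpha n).
  (* Point mass: e = 0 stops the loop before its first round, and the constant [rho], fixed point
     minus [sigma], makes the initial coefficients exact. *)
  apply: (@moment_program_estimates _ _ _
    (fun=> n%:R / (N%:R - 1) - sigma) 0 0); rewrite ?rmorph0 ?lexx ?ltr01 //.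
  move=> m eps l [|r] j eps0 [_ _ _ hr] j0; last first.
    by have := hr 0%N (ltn0Sn r); rewrite expr0n /= ltNge ltW.
  rewrite /= (centered_moment_point_mass j an hs) -mulr_suml -mulr_suml halpha.2 mul1r.
  rewrite mulrCA divff ?pnatr_eq0 -?lt0n ?fact_gt0 // mulr1.
  rewrite rmorphB fmorph_div rmorphB rmorph1 !rmorph_nat.
  by rewrite subrr normr0 ltW.
(* Program literals are rational, so a rational contraction factor is taken between the largest
   weight and 1. *)
have [e /andP[e0 e1] ae] : exists2 e : rat, 0 <= (ratr e : R) < 1 &
    forall n, alpha n <= ratr e.
  pose a := \big[Num.max/0]_(n < N) alpha n.
  have a1 : a < 1.
    apply: bigmax_lt => // n _; rewrite ltNge; apply/negP => an.
    by apply: nodeg; exists n.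
  have [e] := rat_in_itvoo a1; rewrite in_itv /= => /andP[ae e1]; exists e.
    rewrite e1 andbT; apply: le_trans (ltW ae).
    exact: bigmax_ge_id.
  by move=> n; apply: le_trans (ltW ae); exact: le_bigmax.
apply: (@moment_program_estimates _ _ _
    (fun n => (n%:R - sigma * (N%:R - 1)) / N%:R) e N%:R^-1); first by rewrite e0.
move=> m eps l r j eps0 [_ _ er _] j0.
apply: le_trans er.
have fact_unit : j`!%:R != 0 :> R by rewrite pnatr_eq0 -lt0n fact_gt0.
have := iter_transfer_doubling alpha N0 s r j.
rewrite fmorphV rmorph_nat.
have -> : (fun i => \sum_(n < N) alpha n *
     ((n%:R - s * (N%:R - 1)) / N%:R) ^+ i / i`!%:R) =
   (fun i => \sum_(d < N) alpha d *
     ratr ((d%:R - sigma * (N%:R - 1)) / N%:R) ^+ i / i`!%:R).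
  apply: funext => i; apply: eq_bigr => n _; congr (_ * _ ^+ _ / _).
  by rewrite fmorph_div rmorphB rmorphM rmorphB rmorph1 !rmorph_nat.
move=> <-; rewrite mulrCA divff // mulr1.
exact: centered_moment_approx.
Qed.

Lemma moment_I_centered : moment_I mu = centered_moment (ratr 0).
Proof.
apply: funext => j; rewrite /moment_I /centered_moment rmorph0.
by apply: eq_Rintegral => x _; rewrite subr0.
Qed.

(** Change of variables along [recenter], which pulls [-1/2, 1/2] back to [0, 1]. *)
Lemma moment_J_centered : moment_J mu = centered_moment (ratr 2^-1).
Proof.
apply: funext => j; rewrite /moment_J /centered_moment /Rintegral.
rewrite fmorphV rmorph_nat; congr fine.
have pre : @recenter R @^-1` `[- 2^-1, 2^-1]%classic = `[0, 1]%classic.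
  by apply/seteqP; split=> x /=; rewrite !in_itv /= /recenter; lra.
rewrite integral_pushforward ?pre //.
- apply/measurable_EFinP.
  exact: (continuous_measurable_fun (@exprn_continuous R j)).
- exact: (integrable_continuous hmu (@continuous_centered_power 2^-1 j)).
Qed.

End Moments.

Theorem mainTheorem5 (R : realType) (N : nat) (hN : (2 <= N)%N)
    (alpha : 'I_N -> R) (halpha : in_simplex alpha)
    (mu : probability (measurableTypeR R) R)
    (hmu : is_weighted_cantor alpha mu) :
  (exists (p : prog) (T : nat -> R -> nat),
     estimates_in_time alpha p (moment_I mu) T /\ time_bound T) /\
  (palindromic alpha ->
   exists (p : prog) (T : nat -> R -> nat),
     estimates_in_time alpha p (moment_J mu) T /\ time_bound T).
Proof.
split=> [|_].
  rewrite (moment_I_centered mu); apply: (centered_moment_estimates hN halpha hmu).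
  by rewrite rmorph0 lexx ler01.
rewrite (moment_J_centered hmu); apply: (centered_moment_estimates hN halpha hmu).
by rewrite fmorphV rmorph_nat; apply/andP; split; lra.
Qed.
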